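(* Let $M$ be an overt commutative localic monoid and suppose that $\mathscr{S}M$, the frame of saturated opens of $M$, is a dualisable suplattice. Then the functor $\overline{\mathrm{OPMAI}}_M\colon\mathbf{Quant}_\top\to\mathbf{Set}$ is representable, with representing object $(\mathscr{S}M)^* \cong \mathscr{M}M$ and universal element $(\mathscr{M}M \otimes \kappa)\eta(\top)\in\mathscr{M}M\otimes\mathcal{O}M$, where $\eta\colon\Omega\to\mathscr{M}M\otimes\mathscr{S}M$ is the unit of the duality between $\mathscr{S}M$ and $\mathscr{M}M$.
   Context: Everything is constructive (valid in any elementary topos with natural numbers object). $\Omega$ is the frame of truth values. $\mathbf{Sup}$ is the category of suplattices (posets with arbitrary joins, join-preserving maps), symmetric monoidal closed with tensor $\otimes$ (classifying maps preserving joins in each variable), unit $\Omega$, and internal hom $\hom(-,-)$ ordered pointwise; $\Delta\colon\Omega\otimes\Omega\cong\Omega$. Quantales are commutative monoids in $\mathbf{Sup}$; a quantale is two-sided if its unit is its top element. $\mathbf{Quant}_\top$ is the category of two-sided quantales and quantale homomorphisms. Frames are the two-sided quantales with idempotent multiplication; the coproduct $Q\oplus Q'$ of two-sided quantales (or frames) has underlying suplattice $Q\otimes Q'$ with componentwise multiplication. For a locale $X$, $\mathcal{O}X$ is its frame of opens. $X$ is overt if $\mathcal{O}X$ has a base of positive elements ($a$ is positive if $a\le\bigvee I$ implies $I$ is inhabited); equivalently, the locale map $X\to 1$ is open. A commutative localic monoid $M$ is a commutative monoid object in locales; $\epsilon_1\colon\mathcal{O}M\to\Omega$ and $\mu_\times\colon\mathcal{O}M\to\mathcal{O}M\oplus\mathcal{O}M$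 are the frame maps corresponding to the unit and multiplication, and $\iota_1,\iota_2\colon\mathcal{O}M\to\mathcal{O}M\oplus\mathcal{O}M$ are the coproduct injections. $\overline{\mathrm{OPMAI}}_M(Q)$ is the set of $u\in Q\oplus\mathcal{O}M$ such that $(Q\oplus\epsilon_1)(u)=1$ and $(Q\oplus\mu_\times)(u)=(Q\oplus\iota_1)(u)\cdot(Q\oplus\iota_2)(u)$; a morphism $g\colon Q\to Q'$ acts by $u\mapsto(g\oplus\mathcal{O}M)(u)$. Saturated opens: $\mathscr{S}M=\{s\in\mathcal{O}M\mid\mu_\times(s)\le\iota_1(s)\}$, a subframe with inclusion $\kappa\colon\mathscr{S}M\hookrightarrow\mathcal{O}M$. Overt weakly closed sublocales of $M$ are identified with elements of $\hom(\mathcal{O}M,\Omega)$, which is a quantale under $f\cdot g=\Delta(f\otimes g)\mu_\times$ with unit $\epsilon_1$. A monoid ideal is $I\in\hom(\mathcal{O}M,\Omega)$ with $I=I\cdot\top$; the quantale of monoid ideals $\mathscr{M}M$ is the two-sided reflection of $\hom(\mathcal{O}M,\Omega)$, i.e. the quotient by the nucleus $W\mapsto W\cdot\top$, whose elements are the monoid ideals. When $M$ is overt, $\mathscr{M}M\cong\hom(\mathscr{S}M,\Omega)$ via $h\mapsto h\kappa$; so if $\mathscr{S}M$ is dualisable, its dual $(\mathscr{S}M)^*$ is $\mathscr{M}M$, with counit $\mathscr{S}M\otimes\mathscr{M}M\to\Omega$ given by evaluation and unit $\eta$ determined by the triangle identities. *)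

(* Defs.v *)
(* The ambient topos is rendered by the impredicative sort [Prop] as the frame
   of truth values, with propositional and functional extensionality; subsets
   of [A] are predicates [A -> Prop].  Neither excluded middle nor choice is
   used. *)

From Stdlib Require Import PropExtensionality FunctionalExtensionality.

Set Implicit Arguments.
Unset Strict Implicit.
Unset Printing Implicit Defensive.

Record suplattice := Suplattice {
  sl_car :> Type;
  le : sl_car -> sl_car -> Prop;
  sup : (sl_car -> Prop) -> sl_car;
  le_refl : forall x, le x x;
  le_trans : forall x y z, le x y -> le y z -> le x z;
  le_antisym : forall x y, le x y -> le y x -> x = y;
  sup_ub : forall (S : sl_car -> Prop) x, S x -> le x (sup S);
  sup_lub : forall (S : sl_car -> Prop) y,
      (forall x, S x -> le x y) -> le (sup S) y
}.

Arguments le {_} _ _.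
Arguments sup {_} _.

Declare Scope sup_scope.
Delimit Scope sup_scope with sup.
Open Scope sup_scope.
Notation "x ≤ y" := (le x y) (at level 70, no associativity) : sup_scope.

Definition top (A : suplattice) : A := sup (fun _ => True).

Lemma le_top (A : suplattice) (x : A) : x ≤ top A.
Proof. now apply sup_ub. Qed.

Definition image (A B : Type) (f : A -> B) (S : A -> Prop) : B -> Prop :=
  fun y => exists x, S x /\ f x = y.

Definition preserves_sups (A B : suplattice) (f : A -> B) : Prop :=
  forall S : A -> Prop, f (sup S) = sup (image f S).

Lemma sup_image_le (A : Type) (B : suplattice) (f : A -> B) (S : A -> Prop) (y : B) :
  sup (image f S) ≤ y <-> forall x, S x -> f x ≤ y.
Proof.
  split.
  - intros H x Sx; eapply le_trans; [|exact H].
    apply sup_ub; now exists x.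
  - intros H; apply sup_lub; intros z [x [Sx <-]]; auto.
Qed.

Lemma sup_ext (A : suplattice) (S T : A -> Prop) :
  (forall x, S x <-> T x) -> sup S = sup T.
Proof.
  intros H; f_equal; apply functional_extensionality; intros x.
  now apply propositional_extensionality.
Qed.

Lemma le_iff_eq (A : suplattice) (x y : A) :
  (forall z, x ≤ z <-> y ≤ z) -> x = y.
Proof. intros H; apply le_antisym; apply H; apply le_refl. Qed.

Lemma preserves_sups_adj (A B : suplattice) (f : A -> B) (g : B -> A) :
  (forall x y, f x ≤ y <-> x ≤ g y) -> preserves_sups f.
Proof.
  intros H S; apply le_iff_eq; intros z.
  rewrite sup_image_le, H; split.
  - intros K x Sx; apply H; eapply le_trans; [|exact K]; now apply sup_ub.
  - intros K; apply sup_lub; intros x Sx; apply H; auto.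
Qed.

Record sup_hom (A B : suplattice) := SupHom {
  sh_fun :> A -> B;
  sh_sup : preserves_sups sh_fun
}.

Lemma sup_hom_ext (A B : suplattice) (f g : sup_hom A B) :
  (forall x, f x = g x) -> f = g.
Proof.
  destruct f as [f Hf], g as [g Hg]; simpl; intros E.
  assert (f = g) as -> by now apply functional_extensionality.
  now rewrite (proof_irrelevance _ Hf Hg).
Qed.

Lemma sup_pair (A : suplattice) (x y : A) :
  x ≤ y -> sup (fun z => z = x \/ z = y) = y.
Proof.
  intros H; apply le_antisym.
  - apply sup_lub; intros z [->| ->]; auto using le_refl.
  - apply sup_ub; now right.
Qed.

Lemma preserves_sups_mono (A B : suplattice) (f : A -> B) :
  preserves_sups f -> forall x y, x ≤ y -> f x ≤ f y.
Proof.
  intros Hf x y H; rewrite <- (sup_pair H), Hf.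
  apply sup_ub; exists x; auto.
Qed.

Lemma sh_mono (A B : suplattice) (f : sup_hom A B) x y : x ≤ y -> f x ≤ f y.
Proof. apply preserves_sups_mono, sh_sup. Qed.

Lemma id_sups (A : suplattice) : preserves_sups (fun x : A => x).
Proof. apply preserves_sups_adj with (g := fun x => x); tauto. Qed.

Definition id_hom (A : suplattice) : sup_hom A A := SupHom (@id_sups A).

Lemma comp_sups (A B C : suplattice) (g : sup_hom B C) (f : sup_hom A B) :
  preserves_sups (fun x => g (f x)).
Proof.
  intros S; rewrite !sh_sup; apply sup_ext; intros z; split.
  - intros [y [[x [Sx <-]] <-]]; now exists x.
  - intros [x [Sx <-]]; exists (f x); split; auto; now exists x.
Qed.

Definition comp (A B C : suplattice) (g : sup_hom B C) (f : sup_hom A B) :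
  sup_hom A C := SupHom (comp_sups g f).

Lemma compE (A B C : suplattice) (g : sup_hom B C) (f : sup_hom A B) x :
  comp g f x = g (f x).
Proof. reflexivity. Qed.

Definition is_iso (A B : suplattice) (f : sup_hom A B) : Prop :=
  exists g : sup_hom B A, (forall x, g (f x) = x) /\ (forall y, f (g y) = y).

Definition Omega : suplattice.
Proof.
  refine (@Suplattice Prop (fun p q => p -> q)
            (fun S => exists p, S p /\ p) _ _ _ _ _); try tauto.
  - intros; now apply propositional_extensionality.
  - firstorder.
  - firstorder.
Defined.

Definition sup_closed (A : suplattice) (P : A -> Prop) : Prop :=
  forall S : A -> Prop, (forall x, S x -> P x) -> P (sup S).

Lemma sub_closed (A : suplattice) (P : A -> Prop) (H : sup_closed P)
  (S : {x | P x} -> Prop) : P (sup (image (@proj1_sig _ P) S)).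
Proof. apply H; intros x [[y Py] [_ <-]]; exact Py. Qed.

Lemma sig_ext (A : Type) (P : A -> Prop) (x y : {x | P x}) :
  proj1_sig x = proj1_sig y -> x = y.
Proof.
  destruct x as [x Px], y as [y Py]; simpl; intros ->.
  now rewrite (proof_irrelevance _ Px Py).
Qed.

Definition sub_suplattice (A : suplattice) (P : A -> Prop)
  (H : sup_closed P) : suplattice.
Proof.
  refine (@Suplattice {x : A | P x} (fun x y => proj1_sig x ≤ proj1_sig y)
            (fun S => exist _ _ (sub_closed H S)) _ _ _ _ _).
  - intros; apply le_refl.
  - intros; eapply le_trans; eauto.
  - intros; apply sig_ext; now apply le_antisym.
  - intros S x Sx; simpl; apply sup_ub; now exists x.
  - intros S y K; simpl; apply sup_image_le; exact K.
Defined.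

Definition sub_incl (A : suplattice) (P : A -> Prop) (H : sup_closed P) :
  sup_hom (sub_suplattice H) A.
Proof. now exists (@proj1_sig A P). Defined.

Lemma hom_sup_sups (A B : suplattice) (F : sup_hom A B -> Prop) :
  preserves_sups (fun x => sup (image (fun f : sup_hom A B => f x) F)).
Proof.
  intros S; apply le_iff_eq; intros z; rewrite !sup_image_le; split.
  - intros H x Sx; apply sup_image_le; intros f Ff.
    eapply le_trans; [|apply (H f Ff)]; apply sh_mono; now apply sup_ub.
  - intros H f Ff; rewrite sh_sup; apply sup_image_le; intros x Sx.
    specialize (H x Sx); rewrite sup_image_le in H; auto.
Qed.

Definition hom (A B : suplattice) : suplattice.
Proof.
  refine (@Suplattice (sup_hom A B) (fun f g => forall x, f x ≤ g x)
            (fun F => SupHom (hom_sup_sups F)) _ _ _ _ _).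
  - intros f x; apply le_refl.
  - intros f g h H K x; eapply le_trans; eauto.
  - intros f g H K; apply sup_hom_ext; intros x; now apply le_antisym.
  - intros F f Ff x; simpl; apply sup_ub; now exists f.
  - intros F g H x; simpl; apply sup_image_le; intros f Ff; now apply H.
Defined.

Record bihom (A B C : suplattice) := Bihom {
  bh_fun :> A -> B -> C;
  bh_supl : forall b, preserves_sups (fun a => bh_fun a b);
  bh_supr : forall a, preserves_sups (bh_fun a)
}.

Definition bh_left (A B C : suplattice) (f : bihom A B C) (b : B) :
  sup_hom A C := SupHom (bh_supl f b).
Definition bh_right (A B C : suplattice) (f : bihom A B C) (a : A) :
  sup_hom B C := SupHom (bh_supr f a).

(** An element [t] of [A ⊗ B] is represented by the set of pairs [(a, b)]
    with [a ⊗ b ≤ t]; the sets arising in this way are those closed under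
    joins in each variable separately (in particular they are downsets). *)

Record tens_elt (A B : suplattice) := TensElt {
  t_rel :> A -> B -> Prop;
  t_supl : forall (S : A -> Prop) b,
      (forall a, S a -> t_rel a b) <-> t_rel (sup S) b;
  t_supr : forall a (S : B -> Prop),
      (forall b, S b -> t_rel a b) <-> t_rel a (sup S)
}.

Definition tens_le (A B : suplattice) (s t : tens_elt A B) : Prop :=
  forall a b, s a b -> t a b.

Lemma tens_elt_ext (A B : suplattice) (s t : tens_elt A B) :
  tens_le s t -> tens_le t s -> s = t.
Proof.
  destruct s as [s Hs1 Hs2], t as [t Ht1 Ht2]; unfold tens_le; simpl.
  intros H K.
  assert (s = t) as ->.
  { apply functional_extensionality; intros a.
    apply functional_extensionality; intros b.
    apply propositional_extensionality; split; auto. }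
  now rewrite (proof_irrelevance _ Hs1 Ht1), (proof_irrelevance _ Hs2 Ht2).
Qed.

Definition tens_inter (A B : suplattice) (U : tens_elt A B -> Prop) :
  tens_elt A B.
Proof.
  exists (fun a b => forall t : tens_elt A B, U t -> t a b).
  - intros S b; split.
    + intros H t Ut; apply t_supl; intros a Sa; now apply H.
    + intros H a Sa t Ut; specialize (H t Ut); rewrite <- t_supl in H; auto.
  - intros a S; split.
    + intros H t Ut; apply t_supr; intros b Sb; now apply H.
    + intros H b Sb t Ut; specialize (H t Ut); rewrite <- t_supr in H; auto.
Defined.

Definition tens (A B : suplattice) : suplattice.
Proof.
  refine (@Suplattice (tens_elt A B) (@tens_le A B)
            (fun T => tens_inter (fun u => forall t, T t -> tens_le t u))
            _ _ _ _ _); unfold tens_le.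
  - auto.
  - auto.
  - intros; now apply tens_elt_ext.
  - intros T t Tt a b tab u Hu; exact (Hu t Tt a b tab).
  - intros T u H a b K; apply K; exact H.
Defined.

Notation "A ⊗ B" := (tens A B) (at level 40, left associativity) : sup_scope.

Definition pure (A B : suplattice) (a : A) (b : B) : A ⊗ B :=
  tens_inter (fun t => t a b).

Lemma pure_le (A B : suplattice) (a : A) (b : B) (t : A ⊗ B) :
  pure a b ≤ t <-> (t : tens_elt A B) a b.
Proof.
  split.
  - intros H; apply H; intros u Hu; exact Hu.
  - intros H a' b' K; now apply K.
Qed.

Definition pure_bihom (A B : suplattice) : bihom A B (A ⊗ B).
Proof.
  exists (@pure A B).
  - intros b S; apply le_iff_eq; intros t.
    rewrite sup_image_le, pure_le, <- t_supl.
    split; intros H x Sx; apply pure_le; auto.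
  - intros a S; apply le_iff_eq; intros t.
    rewrite sup_image_le, pure_le, <- t_supr.
    split; intros H x Sx; apply pure_le; auto.
Defined.

Lemma tens_sup_pure (A B : suplattice) (t : A ⊗ B) :
  t = sup (fun s => exists a b, (t : tens_elt A B) a b /\ s = pure a b).
Proof.
  apply le_iff_eq; intros u; split.
  - intros H; apply sup_lub; intros s (a & b & tab & ->).
    apply pure_le; now apply H.
  - intros H a b tab; apply pure_le; eapply le_trans; [|exact H].
    apply sup_ub; now exists a, b.
Qed.

Definition tens_elim (A B C : suplattice) (f : bihom A B C) :
  sup_hom (A ⊗ B) C.
Proof.
  exists (fun t : tens_elt A B => sup (fun c => exists a b, t a b /\ c = f a b)).
  assert (Hl : forall (c : C) (S : A -> Prop) b,
             (forall a, S a -> f a b ≤ c) <-> f (sup S) b ≤ c).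
  { intros c S b; rewrite (bh_supl f b S), sup_image_le; reflexivity. }
  assert (Hr : forall (c : C) a (S : B -> Prop),
             (forall b, S b -> f a b ≤ c) <-> f a (sup S) ≤ c).
  { intros c a S; rewrite (bh_supr f a S), sup_image_le; reflexivity. }
  apply (@preserves_sups_adj (A ⊗ B) C) with
    (g := fun c : C => TensElt (t_rel := fun a b => f a b ≤ c) (Hl c) (Hr c)).
  intros t c; split.
  - intros H a b tab; simpl; eapply le_trans; [|exact H].
    apply sup_ub; now exists a, b.
  - intros H; apply sup_lub; intros x (a & b & tab & ->); now apply H.
Defined.

Lemma tens_elim_pure (A B C : suplattice) (f : bihom A B C) a b :
  tens_elim f (pure a b) = f a b.
Proof.
  apply le_antisym.
  - assert (Hl : forall (S : A -> Prop) y,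
               (forall x, S x -> f x y ≤ f a b) <-> f (sup S) y ≤ f a b).
    { intros S y; rewrite (bh_supl f y S), sup_image_le; reflexivity. }
    assert (Hr : forall x (S : B -> Prop),
               (forall y, S y -> f x y ≤ f a b) <-> f x (sup S) ≤ f a b).
    { intros x S; rewrite (bh_supr f x S), sup_image_le; reflexivity. }
    apply sup_lub; intros c (x & y & K & ->).
    apply (K (TensElt (t_rel := fun x y => f x y ≤ f a b) Hl Hr)).
    apply le_refl.
  - apply sup_ub; exists a, b; split; auto.
    intros u Hu; exact Hu.
Qed.

Lemma tens_ind (A B : suplattice) (P : A ⊗ B -> Prop) :
  (forall a b, P (pure a b)) ->
  (forall S : A ⊗ B -> Prop, (forall t, S t -> P t) -> P (sup S)) ->
  forall t, P t.
Proof.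
  intros Hp Hs t; rewrite (tens_sup_pure t); apply Hs.
  intros s (a & b & _ & ->); apply Hp.
Qed.

Lemma tens_ext (A B C : suplattice) (f g : sup_hom (A ⊗ B) C) :
  (forall a b, f (pure a b) = g (pure a b)) -> forall t, f t = g t.
Proof.
  intros H; apply tens_ind; auto.
  intros S HS; rewrite !sh_sup; apply sup_ext; intros z.
  split; intros [x [Sx <-]]; exists x; rewrite ?HS; auto.
Qed.

Definition bh_pre (A A' B B' C : suplattice) (h : bihom A' B' C)
  (f : sup_hom A A') (g : sup_hom B B') : bihom A B C.
Proof.
  exists (fun a b => h (f a) (g b)).
  - intros b; exact (sh_sup (comp (bh_left h (g b)) f)).
  - intros a; exact (sh_sup (comp (bh_right h (f a)) g)).
Defined.

Definition bh_post (A B C D : suplattice) (k : sup_hom C D) (h : bihom A B C) :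
  bihom A B D.
Proof.
  exists (fun a b => k (h a b)).
  - intros b; exact (sh_sup (comp k (bh_left h b))).
  - intros a; exact (sh_sup (comp k (bh_right h a))).
Defined.

Definition bh_flip (A B C : suplattice) (h : bihom A B C) : bihom B A C :=
  Bihom (bh_fun := fun b a => h a b) (fun a => bh_supr h a) (fun b => bh_supl h b).

Lemma hom_sups (A B C : suplattice) (h : A -> hom B C) :
  (forall b, preserves_sups (fun a => (h a : sup_hom B C) b)) ->
  preserves_sups h.
Proof.
  intros H S; apply sup_hom_ext; intros b.
  refine (eq_trans (H b S) _); apply (@sup_ext C); intros z; split.
  - intros [a [Sa <-]]; exists (h a); split; auto; now exists a.
  - intros [k [[a [Sa <-]] <-]]; now exists a.
Qed.

Definition curry (A B C : suplattice) (h : bihom A B C) : sup_hom A (hom B C).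
Proof.
  exists (fun a => bh_right h a : hom B C).
  apply hom_sups; intros b; exact (bh_supl h b).
Defined.

Definition uncurry (A B C : suplattice) (f : sup_hom A (hom B C)) : bihom A B C.
Proof.
  exists (fun a b => (f a : sup_hom B C) b).
  - intros b S; rewrite sh_sup; simpl; apply sup_ext; intros z; split.
    + intros [k [[a [Sa <-]] <-]]; now exists a.
    + intros [a [Sa <-]]; exists (f a); split; auto; now exists a.
  - intros a; apply sh_sup.
Defined.

Definition tens_map (A A' B B' : suplattice) (f : sup_hom A A')
  (g : sup_hom B B') : sup_hom (A ⊗ B) (A' ⊗ B') :=
  tens_elim (bh_pre (pure_bihom A' B') f g).

Lemma tens_map_pure (A A' B B' : suplattice) (f : sup_hom A A')
  (g : sup_hom B B') a b : tens_map f g (pure a b) = pure (f a) (g b).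
Proof. exact (tens_elim_pure _ a b). Qed.

Definition swap (A B : suplattice) : sup_hom (A ⊗ B) (B ⊗ A) :=
  tens_elim (bh_flip (pure_bihom B A)).

Lemma swap_pure (A B : suplattice) (a : A) (b : B) :
  swap A B (pure a b) = pure b a.
Proof. exact (tens_elim_pure _ a b). Qed.

Definition assoc_bihom (A B C : suplattice) :
  bihom A B (hom C (A ⊗ (B ⊗ C))).
Proof.
  exists (fun a b =>
    comp (bh_right (pure_bihom A (B ⊗ C)) a) (bh_right (pure_bihom B C) b)
      : hom C (A ⊗ (B ⊗ C))).
  - intros b; apply hom_sups; intros c.
    exact (bh_supl (pure_bihom A (B ⊗ C)) (pure b c)).
  - intros a; apply hom_sups; intros c.
    exact (sh_sup (comp (bh_right (pure_bihom A (B ⊗ C)) a)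
                     (bh_left (pure_bihom B C) c))).
Defined.

Definition assoc (A B C : suplattice) :
  sup_hom ((A ⊗ B) ⊗ C) (A ⊗ (B ⊗ C)) :=
  tens_elim (uncurry (tens_elim (assoc_bihom A B C))).

Lemma assoc_pure (A B C : suplattice) (a : A) (b : B) (c : C) :
  assoc A B C (pure (pure a b) c) = pure a (pure b c).
Proof.
  unfold assoc; rewrite tens_elim_pure.
  change ((tens_elim (assoc_bihom A B C) (pure a b) : sup_hom _ _) c
          = pure a (pure b c)).
  now rewrite tens_elim_pure.
Qed.

Definition assoc_inv (A B C : suplattice) :
  sup_hom (A ⊗ (B ⊗ C)) ((A ⊗ B) ⊗ C).
Proof.
  refine (comp (swap C (A ⊗ B)) (comp (tens_map (id_hom C) (swap B A)) _)).
  exact (comp (assoc C B A) (comp (swap A (C ⊗ B)) (tens_map (id_hom A) (swap B C)))).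
Defined.

Lemma assoc_inv_pure (A B C : suplattice) (a : A) (b : B) (c : C) :
  assoc_inv A B C (pure a (pure b c)) = pure (pure a b) c.
Proof.
  unfold assoc_inv; rewrite !compE.
  rewrite tens_map_pure, !swap_pure, assoc_pure, tens_map_pure, !swap_pure.
  reflexivity.
Qed.

(* [scale p x] is the join of the subsingleton { x | p }. *)
Definition scale (A : suplattice) : bihom Omega A A.
Proof.
  exists (fun (p : Prop) x => sup (fun y => p /\ y = x)).
  - intros x S; apply le_iff_eq; intros z; rewrite sup_image_le; split.
    + intros H p Sp; apply sup_lub; intros y [Hp ->].
      eapply le_trans; [|exact H]; apply sup_ub; split; auto; now exists p.
    + intros H; apply sup_lub; intros y [[p [Sp Hp]] ->].
      eapply le_trans; [|exact (H p Sp)]; apply sup_ub; auto.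
  - intros p S; apply le_iff_eq; intros z; rewrite sup_image_le; split.
    + intros H x Sx; apply sup_lub; intros y [Hp ->].
      eapply le_trans; [now apply sup_ub, Sx|].
      eapply le_trans; [|exact H]; apply sup_ub; auto.
    + intros H; apply sup_lub; intros y [Hp ->]; apply sup_lub; intros x Sx.
      eapply le_trans; [|exact (H x Sx)]; apply sup_ub; auto.
Defined.

Lemma scale_top (A : suplattice) (x : A) : scale A (top Omega) x = x.
Proof.
  apply le_antisym.
  - apply sup_lub; intros y [_ ->]; apply le_refl.
  - apply sup_ub; split; auto; now exists True.
Qed.

Definition lunit (A : suplattice) : sup_hom (Omega ⊗ A) A := tens_elim (scale A).
Definition lunit_inv (A : suplattice) : sup_hom A (Omega ⊗ A) :=
  bh_right (pure_bihom Omega A) (top Omega).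
Definition runit (A : suplattice) : sup_hom (A ⊗ Omega) A :=
  comp (lunit A) (swap A Omega).
Definition runit_inv (A : suplattice) : sup_hom A (A ⊗ Omega) :=
  comp (swap Omega A) (lunit_inv A).

Lemma lunit_pure (A : suplattice) (p : Omega) (x : A) :
  lunit A (pure p x) = scale A p x.
Proof. exact (tens_elim_pure _ p x). Qed.

Lemma runit_pure (A : suplattice) (p : Omega) (x : A) :
  runit A (pure x p) = scale A p x.
Proof.
  change (lunit A (swap A Omega (pure x p)) = scale A p x).
  now rewrite swap_pure, lunit_pure.
Qed.

Lemma lunit_K (A : suplattice) (x : A) : lunit A (lunit_inv A x) = x.
Proof.
  change (lunit A (pure (top Omega) x) = x).
  now rewrite lunit_pure, scale_top.
Qed.

Lemma scale_Omega (p q : Omega) : scale Omega p q = ((p : Prop) /\ (q : Prop)).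
Proof.
  apply propositional_extensionality; split.
  - intros (r & [Hp ->] & Hq); auto.
  - intros [Hp Hq]; now exists q.
Qed.

Definition Delta : sup_hom (Omega ⊗ Omega) Omega := lunit Omega.

Lemma Delta_pure (p q : Omega) :
  Delta (pure p q) = ((p : Prop) /\ (q : Prop)).
Proof. unfold Delta; now rewrite lunit_pure, scale_Omega. Qed.

Definition is_duality (X D : suplattice) (counit : sup_hom (X ⊗ D) Omega)
  (unit : sup_hom Omega (D ⊗ X)) : Prop :=
  (forall x : X,
     lunit X (tens_map counit (id_hom X)
       (assoc_inv X D X
         (tens_map (id_hom X) unit (runit_inv X x)))) = x) /\
  (forall d : D,
     runit D (tens_map (id_hom D) counit
       (assoc D X D
         (tens_map unit (id_hom D) (lunit_inv D d)))) = d).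

Definition dualisable (X : suplattice) : Prop :=
  exists (D : suplattice) (counit : sup_hom (X ⊗ D) Omega)
         (unit : sup_hom Omega (D ⊗ X)), is_duality counit unit.

(** Quantales are commutative; the multiplication [Q ⊗ Q → Q] is given as a map
    preserving joins in each variable. *)

Record quantale := Quantale {
  q_sl :> suplattice;
  mul : bihom q_sl q_sl q_sl;
  one : q_sl;
  mul_assoc : forall a b c, mul (mul a b) c = mul a (mul b c);
  mul_comm : forall a b, mul a b = mul b a;
  mul_1l : forall a, mul one a = a
}.

Arguments mul {_}.
Arguments one {_}.
Notation "a ⋅ b" := (mul a b) (at level 40, left associativity) : sup_scope.

Lemma mul_mono (Q : quantale) (a b a' b' : Q) :
  a ≤ a' -> b ≤ b' -> a ⋅ b ≤ a' ⋅ b'.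
Proof.
  intros H K; eapply le_trans.
  - exact (sh_mono (bh_left mul b) H).
  - exact (sh_mono (bh_right mul a') K).
Qed.

Lemma mul_1r (Q : quantale) (a : Q) : a ⋅ one = a.
Proof. now rewrite mul_comm, mul_1l. Qed.

Record quantale_hom (P Q : quantale) := QuantaleHom {
  qh_sup :> sup_hom P Q;
  qh_mul : forall a b, qh_sup (a ⋅ b) = qh_sup a ⋅ qh_sup b;
  qh_one : qh_sup one = one
}.

Lemma quantale_hom_ext (P Q : quantale) (f g : quantale_hom P Q) :
  (forall x, f x = g x) -> f = g.
Proof.
  destruct f as [f Hf Kf], g as [g Hg Kg]; simpl; intros E.
  assert (f = g) as -> by now apply sup_hom_ext.
  now rewrite (proof_irrelevance _ Hf Hg), (proof_irrelevance _ Kf Kg).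
Qed.

Definition qid (Q : quantale) : quantale_hom Q Q.
Proof. now exists (id_hom Q). Defined.

Definition qcomp (P Q R : quantale) (g : quantale_hom Q R)
  (f : quantale_hom P Q) : quantale_hom P R.
Proof.
  exists (comp g f).
  - intros a b; now rewrite !compE, !qh_mul.
  - now rewrite compE, !qh_one.
Defined.

(** The unit [e] of the subset [P] below need not be that of the ambient
    quantale. *)

Definition mul_closed (Q : quantale) (P : Q -> Prop) : Prop :=
  forall a b, P a -> P b -> P (a ⋅ b).

Definition sub_mul (Q : quantale) (P : Q -> Prop) (Hs : sup_closed P)
  (Hm : mul_closed P) :
  bihom (sub_suplattice Hs) (sub_suplattice Hs) (sub_suplattice Hs).
Proof.
  exists (fun a b : {x | P x} => exist P (proj1_sig a ⋅ proj1_sig b)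
                        (Hm _ _ (proj2_sig a) (proj2_sig b))).
  - intros b S; apply sig_ext.
    refine (eq_trans (sh_sup (comp (bh_left mul (proj1_sig b)) (sub_incl Hs)) S) _).
    apply (@sup_ext Q); intros z; split.
    + intros [a [Sa <-]]; eexists; split; [exists a; split; auto|]; reflexivity.
    + intros [k [[a [Sa <-]] <-]]; now exists a.
  - intros b S; apply sig_ext.
    refine (eq_trans (sh_sup (comp (bh_right mul (proj1_sig b)) (sub_incl Hs)) S) _).
    apply (@sup_ext Q); intros z; split.
    + intros [a [Sa <-]]; eexists; split; [exists a; split; auto|]; reflexivity.
    + intros [k [[a [Sa <-]] <-]]; now exists a.
Defined.

Definition sub_quantale (Q : quantale) (P : Q -> Prop) (Hs : sup_closed P)
  (Hm : mul_closed P) (e : Q) (Pe : P e) (He : forall a, P a -> e ⋅ a = a) :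
  quantale.
Proof.
  refine (@Quantale (sub_suplattice Hs) (sub_mul Hs Hm) (exist P e Pe) _ _ _).
  - intros a b c; apply sig_ext; apply mul_assoc.
  - intros a b; apply sig_ext; apply mul_comm.
  - intros a; apply sig_ext; exact (He _ (proj2_sig a)).
Defined.

Lemma hom_tens_sups (A B C D : suplattice) (h : A -> hom (B ⊗ C) D) :
  (forall b c, preserves_sups (fun a => (h a : sup_hom (B ⊗ C) D) (pure b c))) ->
  preserves_sups h.
Proof.
  intros H S; apply sup_hom_ext; apply tens_ext; intros b c.
  refine (eq_trans (H b c S) _); apply (@sup_ext D); intros z; split.
  - intros [a [Sa <-]]; exists (h a); split; auto; now exists a.
  - intros [k [[a [Sa <-]] <-]]; now exists a.
Qed.

Definition tens_mul_bihom (P Q : quantale) :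
  bihom P Q (hom (P ⊗ Q) (P ⊗ Q)).
Proof.
  exists (fun a b => tens_map (bh_right mul a) (bh_right mul b)
                     : hom (P ⊗ Q) (P ⊗ Q)).
  - intros b; apply hom_tens_sups; intros a' b' S.
    rewrite tens_map_pure.
    refine (eq_trans (sh_sup (comp (bh_left (pure_bihom P Q) (b ⋅ b'))
                                (bh_left mul a')) S) _).
    apply sup_ext; intros z.
    split; intros [a [Sa <-]]; exists a; split; auto;
      rewrite tens_map_pure; reflexivity.
  - intros a; apply hom_tens_sups; intros a' b' S.
    rewrite tens_map_pure.
    refine (eq_trans (sh_sup (comp (bh_right (pure_bihom P Q) (a ⋅ a'))
                                (bh_left mul b')) S) _).
    apply sup_ext; intros z.
    split; intros [b [Sb <-]]; exists b; split; auto;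
      rewrite tens_map_pure; reflexivity.
Defined.

Definition tens_mul (P Q : quantale) : bihom (P ⊗ Q) (P ⊗ Q) (P ⊗ Q) :=
  uncurry (tens_elim (tens_mul_bihom P Q)).

Lemma tens_mul_pure (P Q : quantale) (a a' : P) (b b' : Q) :
  tens_mul P Q (pure a b) (pure a' b') = pure (a ⋅ a') (b ⋅ b').
Proof.
  change ((tens_elim (tens_mul_bihom P Q) (pure a b) : sup_hom _ _)
            (pure a' b') = pure (a ⋅ a') (b ⋅ b')).
  rewrite tens_elim_pure; exact (tens_map_pure _ _ a' b').
Qed.

Lemma bihom_tens_assoc (A B : suplattice) (m : bihom (A ⊗ B) (A ⊗ B) (A ⊗ B)) :
  (forall a b a' b' a'' b'',
     m (m (pure a b) (pure a' b')) (pure a'' b'')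
     = m (pure a b) (m (pure a' b') (pure a'' b''))) ->
  forall t u v, m (m t u) v = m t (m u v).
Proof.
  intros H t u v.
  apply (tens_ext (f := comp (bh_left m v) (bh_left m u))
                  (g := bh_left m (m u v))); clear t; intros a b.
  apply (tens_ext (f := comp (bh_left m v) (bh_right m (pure a b)))
            (g := comp (bh_right m (pure a b)) (bh_left m v))).
  clear u; intros a' b'.
  apply (tens_ext (f := bh_right m (m (pure a b) (pure a' b')))
            (g := comp (bh_right m (pure a b)) (bh_right m (pure a' b')))).
  intros a'' b''; apply H.
Qed.

Lemma tens_ext2 (A B C D E : suplattice) (f g : bihom (A ⊗ B) (C ⊗ D) E) :
  (forall a b c d, f (pure a b) (pure c d) = g (pure a b) (pure c d)) ->
  forall t u, f t u = g t u.
Proof.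
  intros H t u.
  apply (tens_ext (f := bh_left f u) (g := bh_left g u)); clear t; intros a b.
  apply (tens_ext (f := bh_right f (pure a b)) (g := bh_right g (pure a b))).
  intros c d; apply H.
Qed.

Lemma tens_mul_assoc (P Q : quantale) (t u v : P ⊗ Q) :
  tens_mul P Q (tens_mul P Q t u) v = tens_mul P Q t (tens_mul P Q u v).
Proof.
  revert t u v; apply bihom_tens_assoc; intros.
  now rewrite !tens_mul_pure, !mul_assoc.
Qed.

Lemma tens_mul_comm (P Q : quantale) (t u : P ⊗ Q) :
  tens_mul P Q t u = tens_mul P Q u t.
Proof.
  apply (tens_ext2 (f := tens_mul P Q) (g := bh_flip (tens_mul P Q))).
  intros a b a' b'; unfold bh_flip, bh_fun at 2; fold (bh_fun (tens_mul P Q)).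
  now rewrite !tens_mul_pure, (mul_comm a), (mul_comm b).
Qed.

Lemma tens_mul_1l (P Q : quantale) (t : P ⊗ Q) :
  tens_mul P Q (pure one one) t = t.
Proof.
  refine (tens_ext (f := bh_right (tens_mul P Q) (pure one one))
            (g := id_hom (P ⊗ Q)) _ t).
  clear t; intros a b.
  change (tens_mul P Q (pure one one) (pure a b) = pure a b).
  now rewrite tens_mul_pure, !mul_1l.
Qed.

Definition qtens (P Q : quantale) : quantale :=
  @Quantale (P ⊗ Q) (tens_mul P Q) (pure one one)
    (@tens_mul_assoc P Q) (@tens_mul_comm P Q) (@tens_mul_1l P Q).

Lemma tens_map_mul (P P' Q Q' : quantale) (f : quantale_hom P P')
  (g : quantale_hom Q Q') (t u : P ⊗ Q) :
  tens_map f g (tens_mul P Q t u)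
  = tens_mul P' Q' (tens_map f g t) (tens_map f g u).
Proof.
  apply (tens_ext2 (f := bh_post (tens_map f g) (tens_mul P Q))
           (g := bh_pre (tens_mul P' Q') (tens_map f g) (tens_map f g))).
  intros a b a' b'.
  unfold bh_post, bh_pre, bh_fun at 1 3.
  now rewrite tens_mul_pure, !tens_map_pure, tens_mul_pure, !qh_mul.
Qed.

Definition qtens_map (P P' Q Q' : quantale) (f : quantale_hom P P')
  (g : quantale_hom Q Q') : quantale_hom (qtens P Q) (qtens P' Q').
Proof.
  exists (tens_map f g : sup_hom (qtens P Q) (qtens P' Q')).
  - exact (tens_map_mul f g).
  - refine (eq_trans (tens_map_pure f g one one) _).
    rewrite !qh_one; reflexivity.
Defined.

Definition qinl (P Q : quantale) : quantale_hom P (qtens P Q).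
Proof.
  exists (bh_left (pure_bihom P Q) one : sup_hom P (qtens P Q)).
  - intros a b; refine (eq_sym (eq_trans (tens_mul_pure a b one one) _)).
    rewrite mul_1l; reflexivity.
  - reflexivity.
Defined.

Definition qinr (P Q : quantale) : quantale_hom Q (qtens P Q).
Proof.
  exists (bh_right (pure_bihom P Q) one : sup_hom Q (qtens P Q)).
  - intros a b; refine (eq_sym (eq_trans (tens_mul_pure one one a b) _)).
    rewrite mul_1l; reflexivity.
  - reflexivity.
Defined.

Definition two_sided (Q : quantale) : Prop := one = top Q.

Record ts_quantale := TsQuantale {
  ts_q :> quantale;
  ts_two_sided : two_sided ts_q
}.

Lemma qtens_two_sided (P Q : ts_quantale) : two_sided (qtens P Q).
Proof.
  apply le_antisym; [apply le_top|].
  apply (@sup_lub (qtens P Q)); intros t _ a b _.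
  refine (proj1 (pure_le a b (pure one one)) _).
  apply (@le_trans (P ⊗ Q) _ (pure one b)).
  - apply (sh_mono (bh_left (pure_bihom P Q) b)).
    rewrite ts_two_sided; apply le_top.
  - apply (sh_mono (bh_right (pure_bihom P Q) one)).
    rewrite ts_two_sided; apply le_top.
Qed.

(** The coproduct of two-sided quantales, with injections [qinl], [qinr] and
    functorial action [qtens_map]. *)
Definition ts_sum (P Q : ts_quantale) : ts_quantale :=
  TsQuantale (qtens_two_sided P Q).

Notation "P ⊕ Q" := (ts_sum P Q) (at level 50, left associativity) : sup_scope.

Record frame := Frame {
  fr_ts :> ts_quantale;
  fr_idem : forall a : fr_ts, a ⋅ a = a
}.

Lemma ts_mul_le (Q : ts_quantale) (a b : Q) : a ⋅ b ≤ a.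
Proof.
  apply (@le_trans _ _ (a ⋅ one)).
  - apply mul_mono; [apply le_refl|rewrite ts_two_sided; apply le_top].
  - rewrite mul_1r; apply le_refl.
Qed.

Lemma sum_idem (A B : frame) (t : A ⊕ B) : t ⋅ t = t.
Proof.
  apply le_antisym; [apply ts_mul_le|].
  intros a b tab; apply (pure_le a b t) in tab.
  refine (proj1 (pure_le a b (t ⋅ t)) _).
  rewrite <- (fr_idem a), <- (fr_idem b), <- tens_mul_pure.
  exact (@mul_mono (A ⊕ B) _ _ _ _ tab tab).
Qed.

Definition frame_sum (A B : frame) : frame := Frame (@sum_idem A B).

Definition Omega_quantale : quantale.
Proof.
  refine (@Quantale Omega (scale Omega) (top Omega) _ _ _).
  - intros p q r; rewrite !scale_Omega.
    apply propositional_extensionality; tauto.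
  - intros p q; rewrite !scale_Omega.
    apply propositional_extensionality; tauto.
  - exact (@scale_top Omega).
Defined.

Definition Omega_ts : ts_quantale := @TsQuantale Omega_quantale eq_refl.

Lemma Omega_idem (p : Omega_ts) : p ⋅ p = p.
Proof.
  refine (eq_trans (scale_Omega p p) _).
  apply propositional_extensionality; tauto.
Qed.

Definition Omega_frame : frame := Frame Omega_idem.

(** A locale is given by its frame of opens, so that a commutative monoid in
    locales is a cocommutative comonoid in frames with respect to [⊕]; [eps]
    and [mu] are the inverse images of the unit and of the multiplication. *)

Record localic_monoid := LocalicMonoid {
  opens :> frame;
  eps : quantale_hom opens Omega_frame;
  mu : quantale_hom opens (opens ⊕ opens);
  mu_assoc : forall a,
      assoc opens opens opens (qtens_map mu (qid opens) (mu a))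
      = qtens_map (qid opens) mu (mu a);
  mu_unitl : forall a, lunit opens (qtens_map eps (qid opens) (mu a)) = a;
  mu_unitr : forall a, runit opens (qtens_map (qid opens) eps (mu a)) = a;
  mu_comm : forall a, swap opens opens (mu a) = mu a
}.

Arguments eps : clear implicits.
Arguments mu : clear implicits.

Definition positive (A : suplattice) (a : A) : Prop :=
  forall I : A -> Prop, a ≤ sup I -> exists i, I i.

Definition overt (A : frame) : Prop :=
  exists B : A -> Prop,
    (forall b, B b -> positive b) /\
    (forall a, a = sup (fun b => B b /\ b ≤ a)).

Definition saturated (M : localic_monoid) (s : M) : Prop :=
  mu M s ≤ qinl M M s.

Lemma saturated_sup (M : localic_monoid) : sup_closed (@saturated M).
Proof.
  intros S HS; unfold saturated; rewrite !sh_sup.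
  apply sup_image_le; intros s Ss.
  eapply le_trans; [exact (HS s Ss)|].
  apply sup_ub; now exists s.
Qed.

Lemma saturated_mul (M : localic_monoid) : mul_closed (@saturated M).
Proof.
  intros a b Ha Hb; unfold saturated; rewrite !qh_mul.
  now apply (@mul_mono (M ⊕ M)).
Qed.

Lemma saturated_one (M : localic_monoid) : saturated (one : M).
Proof. unfold saturated; rewrite !qh_one; apply le_refl. Qed.

Definition saturated_quantale (M : localic_monoid) : quantale :=
  sub_quantale (@saturated_sup M) (@saturated_mul M) (@saturated_one M)
    (fun a _ => mul_1l a).

Lemma saturated_two_sided (M : localic_monoid) : two_sided (saturated_quantale M).
Proof.
  apply le_antisym; [apply le_top|].
  simpl; rewrite ts_two_sided; apply le_top.
Qed.

Lemma saturated_idem (M : localic_monoid) (a : TsQuantale (@saturated_two_sided M)) :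
  a ⋅ a = a.
Proof. apply sig_ext; exact (fr_idem (proj1_sig a)). Qed.

Definition saturated_opens (M : localic_monoid) : frame := Frame (@saturated_idem M).

Definition kappa (M : localic_monoid) : quantale_hom (saturated_opens M) M.
Proof. now exists (sub_incl (@saturated_sup M) : sup_hom (saturated_opens M) M). Defined.

(** Overt weakly closed sublocales are identified with join-preserving maps
    from the opens to [Omega]; [conv] is induced by the multiplication of [M]. *)

Definition conv (M : localic_monoid) (f g : sup_hom M Omega) :
  sup_hom M Omega :=
  comp (comp Delta (tens_map f g)) (mu M).

Lemma Delta_map_pure (A B : suplattice) (f : sup_hom A Omega)
  (g : sup_hom B Omega) a b :
  comp Delta (tens_map f g) (pure a b) = Delta (pure (f a) (g b)).
Proof. now rewrite compE, tens_map_pure. Qed.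

Definition conv_map (M : localic_monoid) :
  bihom (hom M Omega) (hom M Omega) (hom M Omega).
Proof.
  assert (L : forall F : hom M Omega -> hom (M ⊗ M) Omega,
    preserves_sups F ->
    preserves_sups (fun f => comp (F f : sup_hom _ _) (mu M) : hom M Omega)).
  { intros F HF; apply hom_sups; intros a S.
    rewrite HF; apply (@sup_ext Omega); intros z; split.
    - intros [k [[f [Sf <-]] <-]]; now exists f.
    - intros [f [Sf <-]]; exists (F f); split; auto; now exists f. }
  exists (fun f g => conv f g : hom M Omega).
  - intros g.
    apply (L (fun f => comp Delta (tens_map (f : sup_hom _ _) (g : sup_hom _ _)))).
    apply hom_tens_sups; intros b c S.
    refine (eq_trans (Delta_map_pure _ _ b c) _).
    refine (eq_trans (sh_sup (comp (bh_left (bh_post Delta (pure_bihom Omega Omega))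
                    ((g : sup_hom _ _) c)) (bh_left (uncurry (id_hom (hom M Omega))) b)) S) _).
    apply (@sup_ext Omega); intros z.
    split; intros [f [Sf <-]]; exists f; split; auto;
      [exact (Delta_map_pure f g b c)|exact (eq_sym (Delta_map_pure f g b c))].
  - intros f.
    apply (L (fun g => comp Delta (tens_map (f : sup_hom _ _) (g : sup_hom _ _)))).
    apply hom_tens_sups; intros b c S.
    refine (eq_trans (Delta_map_pure _ _ b c) _).
    refine (eq_trans (sh_sup (comp (bh_right (bh_post Delta (pure_bihom Omega Omega))
                    ((f : sup_hom _ _) b)) (bh_left (uncurry (id_hom (hom M Omega))) c)) S) _).
    apply (@sup_ext Omega); intros z.
    split; intros [g [Sg <-]]; exists g; split; auto;
      [exact (Delta_map_pure f g b c)|exact (eq_sym (Delta_map_pure f g b c))].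
Defined.

Lemma tens_map_comp (A A' A'' B B' B'' : suplattice) (f' : sup_hom A' A'')
  (f : sup_hom A A') (g' : sup_hom B' B'') (g : sup_hom B B') (t : A ⊗ B) :
  tens_map (comp f' f) (comp g' g) t = tens_map f' g' (tens_map f g t).
Proof.
  refine (tens_ext (f := tens_map (comp f' f) (comp g' g))
            (g := comp (tens_map f' g') (tens_map f g)) _ t); intros a b.
  now rewrite compE, !tens_map_pure.
Qed.

Lemma tens_map_id (A B : suplattice) (t : A ⊗ B) :
  tens_map (id_hom A) (id_hom B) t = t.
Proof.
  refine (tens_ext (f := tens_map (id_hom A) (id_hom B))
            (g := id_hom (A ⊗ B)) _ t); intros a b.
  now rewrite tens_map_pure.
Qed.

Lemma comp_id_l (A B : suplattice) (f : sup_hom A B) : comp (id_hom B) f = f.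
Proof. now apply sup_hom_ext. Qed.

Lemma comp_id_r (A B : suplattice) (f : sup_hom A B) : comp f (id_hom A) = f.
Proof. now apply sup_hom_ext. Qed.

Lemma tens_map_split_l (A A' A'' B B' : suplattice) (f' : sup_hom A' A'')
  (f : sup_hom A A') (g : sup_hom B B') (t : A ⊗ B) :
  tens_map (comp f' f) g t = tens_map f' g (tens_map f (id_hom B) t).
Proof. now rewrite <- tens_map_comp, comp_id_r. Qed.

Lemma tens_map_split_r (A A' B B' B'' : suplattice) (f : sup_hom A A')
  (g' : sup_hom B' B'') (g : sup_hom B B') (t : A ⊗ B) :
  tens_map f (comp g' g) t = tens_map f g' (tens_map (id_hom A) g t).
Proof. now rewrite <- tens_map_comp, comp_id_r. Qed.

Lemma tens_ext3 (A B C D : suplattice) (f g : sup_hom ((A ⊗ B) ⊗ C) D) :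
  (forall a b c, f (pure (pure a b) c) = g (pure (pure a b) c)) ->
  forall t, f t = g t.
Proof.
  intros H; apply tens_ext; intros t c.
  apply (tens_ext (f := comp f (bh_left (pure_bihom (A ⊗ B) C) c))
           (g := comp g (bh_left (pure_bihom (A ⊗ B) C) c))).
  intros a b; apply H.
Qed.

Lemma Delta_assoc (A B C : suplattice) (f : sup_hom A Omega)
  (g : sup_hom B Omega) (h : sup_hom C Omega) (t : (A ⊗ B) ⊗ C) :
  Delta (tens_map (comp Delta (tens_map f g)) h t)
  = Delta (tens_map f (comp Delta (tens_map g h)) (assoc A B C t)).
Proof.
  refine (tens_ext3 (f := comp Delta (tens_map (comp Delta (tens_map f g)) h))
            (g := comp Delta (comp (tens_map f (comp Delta (tens_map g h)))
                                (assoc A B C))) _ t); intros a b c.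
  rewrite !compE, assoc_pure, !tens_map_pure, !compE, !tens_map_pure, !Delta_pure.
  apply propositional_extensionality; tauto.
Qed.

Lemma Delta_swap (A B : suplattice) (f : sup_hom A Omega)
  (g : sup_hom B Omega) (t : A ⊗ B) :
  Delta (tens_map f g t) = Delta (tens_map g f (swap A B t)).
Proof.
  refine (tens_ext (f := comp Delta (tens_map f g))
            (g := comp Delta (comp (tens_map g f) (swap A B))) _ t); intros a b.
  rewrite !compE, swap_pure, !tens_map_pure, !Delta_pure.
  apply propositional_extensionality; tauto.
Qed.

Lemma scale_natural (A B : suplattice) (f : sup_hom A B) (p : Omega) (x : A) :
  f (scale A p x) = scale B p (f x).
Proof.
  refine (eq_trans (sh_sup f _) _); apply sup_ext; intros z; split.
  - intros [y [[Hp ->] <-]]; auto.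
  - intros [Hp ->]; now exists x.
Qed.

Lemma lunit_natural (A B : suplattice) (f : sup_hom A B) (t : Omega ⊗ A) :
  lunit B (tens_map (id_hom Omega) f t) = f (lunit A t).
Proof.
  refine (tens_ext (f := comp (lunit B) (tens_map (id_hom Omega) f))
            (g := comp f (lunit A)) _ t); intros p x.
  rewrite !compE, tens_map_pure, !lunit_pure, scale_natural; reflexivity.
Qed.

Lemma conv_assoc (M : localic_monoid) (f g h : sup_hom M Omega) :
  conv (conv f g) h = conv f (conv g h).
Proof.
  apply sup_hom_ext; intros a; unfold conv; rewrite !compE.
  rewrite tens_map_split_l, tens_map_split_r, Delta_assoc.
  exact (f_equal (fun w => Delta (tens_map f (comp Delta (tens_map g h)) w))
           (mu_assoc a)).
Qed.

Lemma conv_comm (M : localic_monoid) (f g : sup_hom M Omega) :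
  conv f g = conv g f.
Proof.
  apply sup_hom_ext; intros a; unfold conv; rewrite !compE.
  now rewrite Delta_swap, mu_comm.
Qed.

Lemma conv_1l (M : localic_monoid) (f : sup_hom M Omega) :
  conv (eps M) f = f.
Proof.
  apply sup_hom_ext; intros a; unfold conv; rewrite !compE.
  rewrite <- (comp_id_l (eps M)), tens_map_split_l.
  unfold Delta.
  refine (eq_trans (lunit_natural f _) _).
  f_equal; exact (mu_unitl a).
Qed.

Definition sublocale_quantale (M : localic_monoid) : quantale :=
  @Quantale (hom M Omega) (conv_map M) (eps M : sup_hom M Omega)
    (@conv_assoc M) (@conv_comm M) (@conv_1l M).

(** The two-sided reflection of a quantale is its quotient by the nucleus
    [j : a ↦ a ⋅ ⊤].  Since [j] commutes with joins and the product of two fixed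
    points is a fixed point, the joins [j (sup S)] and products [j (a ⋅ b)] of
    the quotient are those of the ambient quantale; its unit is [j one = ⊤]. *)

Definition absorbing (Q : quantale) (a : Q) : Prop := a = a ⋅ top Q.

Lemma absorbing_sup (Q : quantale) : sup_closed (@absorbing Q).
Proof.
  intros S HS; unfold absorbing.
  refine (eq_sym (eq_trans (bh_supl mul (top Q) S) _)).
  apply sup_ext; intros z; split.
  - intros [x [Sx <-]]; rewrite <- (HS x Sx); exact Sx.
  - intros Sz; exists z; split; auto; symmetry; now apply HS.
Qed.

Lemma absorbing_mul (Q : quantale) : mul_closed (@absorbing Q).
Proof.
  intros a b _ Hb; unfold absorbing; rewrite mul_assoc; now f_equal.
Qed.

Lemma absorbing_top (Q : quantale) : absorbing (top Q).
Proof.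
  apply le_antisym; [|apply le_top].
  rewrite <- (mul_1l (top Q)) at 1; apply mul_mono; [apply le_top|apply le_refl].
Qed.

Definition reflection_quantale (Q : quantale) : quantale :=
  sub_quantale (@absorbing_sup Q) (@absorbing_mul Q) (@absorbing_top Q)
    (fun a Ha => eq_trans (mul_comm (top Q) a) (eq_sym Ha)).

Lemma reflection_two_sided (Q : quantale) : two_sided (reflection_quantale Q).
Proof.
  apply le_antisym; [apply le_top|].
  simpl; apply le_top.
Qed.

Definition reflection (Q : quantale) : ts_quantale :=
  TsQuantale (@reflection_two_sided Q).

Definition monoid_ideals (M : localic_monoid) : ts_quantale := reflection (sublocale_quantale M).

Definition ideal_hom (M : localic_monoid) (I : monoid_ideals M) : sup_hom M Omega :=
  proj1_sig I.

Definition ev_bihom (M : localic_monoid) : bihom (saturated_opens M) (monoid_ideals M) Omega :=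
  bh_flip (bh_pre (uncurry (id_hom (hom M Omega)))
             (sub_incl (@absorbing_sup (sublocale_quantale M)) : sup_hom (monoid_ideals M) (hom M Omega))
             (kappa M)).

Definition ev (M : localic_monoid) : sup_hom (saturated_opens M ⊗ monoid_ideals M) Omega :=
  tens_elim (ev_bihom M).

Lemma ev_pure (M : localic_monoid) (s : saturated_opens M) (I : monoid_ideals M) :
  ev M (pure s I) = ideal_hom I (kappa M s).
Proof. exact (tens_elim_pure (ev_bihom M) s I). Qed.

Record set_functor := SetFunctor {
  F_obj :> ts_quantale -> Type;
  F_map : forall P Q : ts_quantale, quantale_hom P Q -> F_obj P -> F_obj Q;
  F_id : forall (Q : ts_quantale) (u : F_obj Q), F_map (qid Q) u = u;
  F_comp : forall (P Q R : ts_quantale) (g : quantale_hom Q R)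
      (f : quantale_hom P Q) (u : F_obj P),
      F_map (qcomp g f) u = F_map g (F_map f u)
}.

Arguments F_map _ {_ _} _ _.

(** [F] is representable, with representing object [R] and universal
    element [u]. *)
Definition represented_by (F : set_functor) (R : ts_quantale) (u : F R) : Prop :=
  forall (Q : ts_quantale) (v : F Q),
    exists! g : quantale_hom R Q, F_map F g u = v.

(* [Q ⊕ Omega_ts] is isomorphic to [Q]; the first equation is stated without
   applying this isomorphism. *)
Definition is_opmai (M : localic_monoid) (Q : ts_quantale) (u : Q ⊕ M) : Prop :=
  qtens_map (qid Q) (eps M) u = (one : Q ⊕ Omega_ts) /\
  qtens_map (qid Q) (mu M) u
  = (qtens_map (qid Q) (qinl M M) u : Q ⊕ (M ⊕ M))
    ⋅ qtens_map (qid Q) (qinr M M) u.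

Lemma qtens_map_interchange (P Q A B : quantale) (g : quantale_hom P Q)
  (f : quantale_hom A B) (u : qtens P A) :
  qtens_map (qid Q) f (qtens_map g (qid A) u)
  = qtens_map g (qid B) (qtens_map (qid P) f u).
Proof.
  refine (eq_trans (eq_sym (tens_map_comp (id_hom Q) g f (id_hom A) u)) _).
  refine (eq_trans _ (tens_map_comp g (id_hom P) (id_hom B) f u)).
  now rewrite !comp_id_l, !comp_id_r.
Qed.

Lemma opmai_map (M : localic_monoid) (P Q : ts_quantale)
  (g : quantale_hom P Q) (u : P ⊕ M) :
  is_opmai u -> is_opmai (qtens_map g (qid M) u : Q ⊕ M).
Proof.
  intros [H1 H2]; split.
  - refine (eq_trans (qtens_map_interchange g (eps M) u) _).
    refine (eq_trans (f_equal (qtens_map g (qid Omega_ts)) H1) _).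
    exact (qh_one (qtens_map g (qid Omega_ts))).
  - refine (eq_trans (qtens_map_interchange g (mu M) u) _).
    refine (eq_trans (f_equal (qtens_map g (qid (M ⊕ M))) H2) _).
    refine (eq_trans (qh_mul (qtens_map g (qid (M ⊕ M))) _ _) _).
    f_equal; symmetry; apply qtens_map_interchange.
Qed.

Definition OPMAI (M : localic_monoid) : set_functor.
Proof.
  refine (@SetFunctor (fun Q => {u : Q ⊕ M | is_opmai u})
            (fun P Q g u => exist _ (qtens_map g (qid M) (proj1_sig u))
                              (opmai_map g (proj2_sig u))) _ _).
  - intros Q u; apply sig_ext; exact (tens_map_id (proj1_sig u)).
  - intros P Q R g f u; apply sig_ext.
    refine (eq_trans _ (tens_map_comp g f (id_hom M) (id_hom M) (proj1_sig u))).
    now rewrite comp_id_l.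
Defined.

(* Main.v *)
(* For overt [M] the saturation [R = (id ⊗ Pos) μ] retracts [OM] onto [SM], and a
   functional on [OM] is a monoid ideal iff it factors through [R]; hence ideals
   are functionals on [SM].  For any dual pair [(X, D)] an element of [D ⊗ Y] is
   determined by its slices along [X], and an element [w] of [Q ⊗ X] is the image
   of the unit under [d ↦ (id ⊗ d)(w)].  Since [Q] is two-sided, the multiplicative
   law of an OPMAI [v] gives [(id ⊗ R) v ≤ v], so [v] lives in [Q ⊗ SM]; the map
   [I ↦ (id ⊗ I) v] it induces on ideals is multiplicative by the same law.
   Conversely the slice of [ι₁ u ⋅ ι₂ u] at a saturated [s] is [(R ⊗ R)(μ s)], which
   equals [μ (R (R s)) = μ s] by coassociativity and cocommutativity. *)

From Stdlib Require Import PropExtensionality.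
Require Import Defs.

Set Implicit Arguments.
Unset Strict Implicit.
Unset Printing Implicit Defensive.

(** * Contracting tensors against functionals *)

Definition slice_l (A B C : suplattice) (k : sup_hom (A ⊗ B) C) (a : A) :
  sup_hom B C := comp k (bh_right (pure_bihom A B) a).
Definition slice_r (A B C : suplattice) (k : sup_hom (A ⊗ B) C) (b : B) :
  sup_hom A C := comp k (bh_left (pure_bihom A B) b).

Definition contract_l (A B : suplattice) (f : sup_hom A Omega) :
  sup_hom (A ⊗ B) B := comp (lunit B) (tens_map f (id_hom B)).
Definition contract_r (A B : suplattice) (h : sup_hom B Omega) :
  sup_hom (A ⊗ B) A := comp (runit A) (tens_map (id_hom A) h).

Lemma contract_l_pure (A B : suplattice) (f : sup_hom A Omega) (a : A) (b : B) :
  contract_l B f (pure a b) = scale B (f a) b.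
Proof. unfold contract_l; now rewrite compE, tens_map_pure, lunit_pure. Qed.

Lemma contract_r_pure (A B : suplattice) (h : sup_hom B Omega) (a : A) (b : B) :
  contract_r A h (pure a b) = scale A (h b) a.
Proof. unfold contract_r; now rewrite compE, tens_map_pure, runit_pure. Qed.

Lemma scale_le (A : suplattice) (p : Omega) (x : A) : scale A p x ≤ x.
Proof. apply sup_lub; intros y [_ ->]; apply le_refl. Qed.

Lemma contract_l_map (A A' B B' : suplattice) (h : sup_hom A' Omega)
  (f : sup_hom A A') (g : sup_hom B B') (t : A ⊗ B) :
  contract_l B' h (tens_map f g t) = g (contract_l B (comp h f) t).
Proof.
  refine (tens_ext (f := comp (contract_l B' h) (tens_map f g))
            (g := comp g (contract_l B (comp h f))) _ t); intros a b.
  now rewrite !compE, tens_map_pure, !contract_l_pure, scale_natural.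
Qed.

Lemma contract_r_map (A A' B B' : suplattice) (h : sup_hom B' Omega)
  (f : sup_hom A A') (g : sup_hom B B') (t : A ⊗ B) :
  contract_r A' h (tens_map f g t) = f (contract_r A (comp h g) t).
Proof.
  refine (tens_ext (f := comp (contract_r A' h) (tens_map f g))
            (g := comp f (contract_r A (comp h g))) _ t); intros a b.
  now rewrite !compE, tens_map_pure, !contract_r_pure, scale_natural.
Qed.

(** A Fubini law: on [pure a b] both orders of contraction give the truth value [f a /\ h b]. *)
Lemma contract_exchange (A B : suplattice) (f : sup_hom A Omega)
  (h : sup_hom B Omega) (t : A ⊗ B) :
  f (contract_r A h t) = h (contract_l B f t).
Proof.
  refine (tens_ext (f := comp f (contract_r A h))
            (g := comp h (contract_l B f)) _ t); intros a b.
  rewrite !compE, contract_l_pure, contract_r_pure, !scale_natural, !scale_Omega.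
  apply propositional_extensionality; tauto.
Qed.

Lemma runit_K (A : suplattice) (t : A ⊗ Omega) : runit_inv A (runit A t) = t.
Proof.
  refine (tens_ext (f := comp (runit_inv A) (runit A))
            (g := id_hom (A ⊗ Omega)) _ t); intros a p.
  rewrite !compE, runit_pure, scale_natural.
  change (scale (A ⊗ Omega) p (swap Omega A (pure (top Omega) a)) = pure a p).
  rewrite swap_pure.
  refine (eq_trans (eq_sym (scale_natural (bh_right (pure_bihom A Omega) a) p
                              (top Omega))) _).
  change (pure a (scale Omega p (top Omega)) = pure a p); f_equal.
  rewrite scale_Omega; apply propositional_extensionality; split; [tauto|].
  intros Hp; split; [exact Hp|now exists True].
Qed.

(** Records that [tens_map] preserves joins in the maps themselves. Expressions in which a tensor
    enters through a functional or a slice thereby become join-preserving in that tensor, so they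
    can be compared on pure tensors. *)
Definition tens_map_bihom (A A' B B' : suplattice) :
  bihom (hom A A') (hom B B') (hom (A ⊗ B) (A' ⊗ B')).
Proof.
  exists (fun f g => tens_map f g : hom (A ⊗ B) (A' ⊗ B')).
  - intros g; apply hom_tens_sups; intros b c S.
    rewrite tens_map_pure.
    refine (eq_trans (sh_sup (comp (bh_left (pure_bihom A' B') ((g : sup_hom _ _) c))
              (bh_left (uncurry (id_hom (hom A A'))) b)) S) _).
    apply (@sup_ext (A' ⊗ B')); intros z.
    split; intros [f [Sf <-]]; exists f; split; auto; rewrite tens_map_pure; reflexivity.
  - intros f; apply hom_tens_sups; intros b c S.
    rewrite tens_map_pure.
    refine (eq_trans (sh_sup (comp (bh_right (pure_bihom A' B') ((f : sup_hom _ _) b))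
              (bh_left (uncurry (id_hom (hom B B'))) c)) S) _).
    apply (@sup_ext (A' ⊗ B')); intros z.
    split; intros [g [Sg <-]]; exists g; split; auto; rewrite tens_map_pure; reflexivity.
Defined.

Definition eval (A B : suplattice) (a : A) : sup_hom (hom A B) B :=
  bh_left (uncurry (id_hom (hom A B))) a.

Definition contract_l_bihom (A B : suplattice) : bihom (hom A Omega) (A ⊗ B) B :=
  bh_post (lunit B)
    (uncurry (bh_left (tens_map_bihom A Omega B B) (id_hom B))).
Definition contract_r_bihom (A B : suplattice) : bihom (A ⊗ B) (hom B Omega) A :=
  bh_flip (bh_post (runit A)
    (uncurry (bh_right (tens_map_bihom A A B Omega) (id_hom A)))).

(** * Dual pairs in terms of slices *)

Definition curry_l (A B C : suplattice) (k : sup_hom (A ⊗ B) C) :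
  sup_hom A (hom B C) := curry (bh_post k (pure_bihom A B)).
Definition curry_r (A B C : suplattice) (k : sup_hom (A ⊗ B) C) :
  sup_hom B (hom A C) := curry (bh_flip (bh_post k (pure_bihom A B))).

(** Only the value of [unit] at [top Omega] enters the triangle identities. Moving the associator
    and the unitors past pure tensors turns each identity into a contraction of that single
    element. *)
Lemma is_dualityE (X D : suplattice) (counit : sup_hom (X ⊗ D) Omega)
  (unit : sup_hom Omega (D ⊗ X)) :
  is_duality counit unit <->
  (forall x, contract_l X (slice_l counit x) (unit (top Omega)) = x) /\
  (forall d, contract_r D (slice_r counit d) (unit (top Omega)) = d).
Proof.
  assert (L : forall x,
    lunit X (tens_map counit (id_hom X) (assoc_inv X D X
         (tens_map (id_hom X) unit (runit_inv X x))))
    = contract_l X (slice_l counit x) (unit (top Omega))).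
  { intros x.
    change (runit_inv X x) with (swap Omega X (pure (top Omega) x)).
    rewrite swap_pure, tens_map_pure.
    refine (tens_ext (f := comp (lunit X) (comp (tens_map counit (id_hom X))
              (comp (assoc_inv X D X) (bh_right (pure_bihom X (D ⊗ X)) x))))
              (g := contract_l X (slice_l counit x)) _ (unit (top Omega))).
    intros d y; rewrite contract_l_pure, !compE.
    change (lunit X (tens_map counit (id_hom X) (assoc_inv X D X (pure x (pure d y))))
      = scale X (counit (pure x d)) y).
    now rewrite assoc_inv_pure, tens_map_pure, lunit_pure. }
  assert (K : forall d,
    runit D (tens_map (id_hom D) counit (assoc D X D
         (tens_map unit (id_hom D) (lunit_inv D d))))
    = contract_r D (slice_r counit d) (unit (top Omega))).
  { intros d.
    change (lunit_inv D d) with (pure (top Omega) d : Omega ⊗ D).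
    rewrite tens_map_pure.
    refine (tens_ext (f := comp (runit D) (comp (tens_map (id_hom D) counit)
              (comp (assoc D X D) (bh_left (pure_bihom (D ⊗ X) D) d))))
              (g := contract_r D (slice_r counit d)) _ (unit (top Omega))).
    intros e x; rewrite contract_r_pure, !compE.
    change (runit D (tens_map (id_hom D) counit (assoc D X D (pure (pure e x) d)))
      = scale D (counit (pure x d)) e).
    now rewrite assoc_pure, tens_map_pure, runit_pure. }
  unfold is_duality; split; intros [H H']; split; intros z;
    first [rewrite L | rewrite K | rewrite <- L | rewrite <- K]; auto.
Qed.

Definition slices_bihom (X D Y : suplattice) (counit : sup_hom (X ⊗ D) Omega) :
  bihom X (D ⊗ Y) Y :=
  bh_pre (contract_l_bihom D Y) (curry_l counit) (id_hom (D ⊗ Y)).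
Definition transpose_bihom (X D Q : suplattice)
  (counit : sup_hom (X ⊗ D) Omega) : bihom (Q ⊗ X) D Q :=
  bh_pre (contract_r_bihom Q X) (id_hom (Q ⊗ X)) (curry_r counit).

Lemma slices_bihomE (X D Y : suplattice) (counit : sup_hom (X ⊗ D) Omega) x
  (t : D ⊗ Y) : slices_bihom Y counit x t = contract_l Y (slice_l counit x) t.
Proof. reflexivity. Qed.

Lemma transpose_bihomE (X D Q : suplattice) (counit : sup_hom (X ⊗ D) Omega)
  (w : Q ⊗ X) d : transpose_bihom Q counit w d = contract_r Q (slice_r counit d) w.
Proof. reflexivity. Qed.

(* Under [D ⊗ Y ≅ hom X Y], [t] corresponds to the map sending [x] to the slice
   of [t] at [x]. *)
Lemma dual_slices (X D Y : suplattice) (counit : sup_hom (X ⊗ D) Omega)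
  (eta : D ⊗ X) :
  (forall d, contract_r D (slice_r counit d) eta = d) ->
  forall t : D ⊗ Y,
    tens_map (id_hom D) (bh_left (slices_bihom Y counit) t) eta = t.
Proof.
  intros H.
  refine (tens_ext (f := comp (eval _ eta) (comp
    (bh_right (tens_map_bihom D D X Y) (id_hom D))
    (curry (bh_flip (slices_bihom Y counit)))))
    (g := id_hom _) _).
  intros d y.
  change (tens_map (id_hom D) (bh_left (slices_bihom Y counit) (pure d y)) eta
          = pure d y).
  rewrite <- (H d) at 2.
  refine (tens_ext
    (f := tens_map (id_hom D) (bh_left (slices_bihom Y counit) (pure d y)))
    (g := comp (bh_left (pure_bihom D Y) y) (contract_r D (slice_r counit d))) _ eta).
  intros e x; rewrite tens_map_pure, !compE, contract_r_pure, scale_natural.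
  change (pure e (slices_bihom Y counit x (pure d y))
          = scale (D ⊗ Y) (counit (pure x d)) (pure e y)).
  rewrite slices_bihomE, contract_l_pure.
  exact (scale_natural (bh_right (pure_bihom D Y) e) (counit (pure x d)) y).
Qed.

(** [dual_slices] rebuilds a tensor from the function that sends [x] to its slice. *)
Lemma dual_ext (X D Y : suplattice) (counit : sup_hom (X ⊗ D) Omega)
  (eta : D ⊗ X) :
  (forall d, contract_r D (slice_r counit d) eta = d) ->
  forall t t' : D ⊗ Y,
    (forall x, contract_l Y (slice_l counit x) t = contract_l Y (slice_l counit x) t') ->
    t = t'.
Proof.
  intros H t t' E; rewrite <- (dual_slices H t), <- (dual_slices H t').
  refine (f_equal (fun f => tens_map (id_hom D) f eta) _).
  apply sup_hom_ext; intros x.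
  change (slices_bihom Y counit x t = slices_bihom Y counit x t').
  rewrite !slices_bihomE; exact (E x).
Qed.

(** The mirror image of [dual_slices], for the correspondence between [Q ⊗ X] and [hom D Q]. On
    [pure q x] the transpose is [d ↦ counit (x, d) · q], and the hypothesis on [eta] contracts it
    back to [x]. *)
Lemma dual_transpose (X D Q : suplattice) (counit : sup_hom (X ⊗ D) Omega)
  (eta : D ⊗ X) :
  (forall x, contract_l X (slice_l counit x) eta = x) ->
  forall w : Q ⊗ X,
    tens_map (bh_right (transpose_bihom Q counit) w) (id_hom X) eta = w.
Proof.
  intros H.
  (* The left side is written as a composite of join-preserving maps applied to [w], which reduces
     the claim to pure [w]. *)
  refine (tens_ext (f := comp (eval _ eta) (comp
    (bh_left (tens_map_bihom D Q X X) (id_hom X))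
    (curry (transpose_bihom Q counit))))
    (g := id_hom _) _).
  intros q x.
  change (tens_map (bh_right (transpose_bihom Q counit) (pure q x)) (id_hom X) eta
          = pure q x).
  rewrite <- (H x) at 2.
  refine (tens_ext
    (f := tens_map (bh_right (transpose_bihom Q counit) (pure q x)) (id_hom X))
    (g := comp (bh_right (pure_bihom Q X) q) (contract_l X (slice_l counit x))) _ eta).
  intros d y; rewrite tens_map_pure, !compE, contract_l_pure, scale_natural.
  change (pure (transpose_bihom Q counit (pure q x) d) y
          = scale (Q ⊗ X) (counit (pure x d)) (pure q y)).
  rewrite transpose_bihomE, contract_r_pure.
  exact (scale_natural (bh_left (pure_bihom Q X) y) (counit (pure x d)) q).
Qed.

(** * Positivity and the saturation operator *)

Lemma positive_sups (A : frame) (A_overt : overt A) :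
  preserves_sups (positive (A := A) : A -> Omega).
Proof.
  destruct A_overt as (B & HB & Hbase).
  intros S; apply propositional_extensionality; split.
  - intros H.
    (* Positivity of [sup S] is tested on the cover by base elements lying below members of [S]. An
       inhabitant [b] is positive by choice of the base, hence so is the [s] above it. *)
    destruct (H (fun b => B b /\ exists s, S s /\ b ≤ s)) as (b & Bb & s & Ss & Hbs).
    + apply sup_lub; intros s Ss; rewrite (Hbase s).
      apply sup_lub; intros b [Bb Hbs]; apply sup_ub; eauto.
    + exists (positive s); split; [now exists s|].
      intros I HI; apply (HB b Bb); eapply le_trans; eauto.
  - intros (p & (s & Ss & <-) & Hs) I HI; apply Hs.
    eapply le_trans; [now apply sup_ub, Ss|exact HI].
Qed.

(* The functional [Pos]: for overt [M] it is the positivity predicate. *)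
Definition full (M : localic_monoid) : sup_hom M Omega := top (hom M Omega).

(** A base element [b] below [a] is positive, so it witnesses that [a] is positive. As [a] is the
    join of such [b], it is covered by the subsingleton of [a] itself. *)
Lemma le_scale_full (M : localic_monoid) (M_overt : overt M) (a : M) :
  a ≤ scale M (full M a) a.
Proof.
  pose (pos := SupHom (positive_sups M_overt)).
  destruct M_overt as (B & HB & Hbase).
  rewrite (Hbase a) at 1; apply sup_lub; intros b [Bb Hba].
  eapply le_trans; [exact Hba|].
  apply sup_ub; split; [|reflexivity].
  (* [full] is the largest join-preserving functional, and positivity is one such functional. *)
  apply (le_top (pos : hom M Omega) a).
  intros I HI; apply (HB b Bb); eapply le_trans; eauto.
Qed.

(** A copy of [mu] typed as a plain suplattice map, so that the lemmas on [tens_map] rewrite without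
    the quantale structure on [M ⊕ M]. *)
Definition comul (M : localic_monoid) : sup_hom M (M ⊗ M) := mu M.

Lemma comul_assoc (M : localic_monoid) (a : M) :
  assoc M M M (tens_map (comul M) (id_hom M) (comul M a))
  = tens_map (id_hom M) (comul M) (comul M a).
Proof. exact (mu_assoc a). Qed.

Lemma comul_comm (M : localic_monoid) (a : M) :
  swap M M (comul M a) = comul M a.
Proof. exact (mu_comm a). Qed.

Lemma contract_r_assoc (A B C : suplattice) (h : sup_hom C Omega)
  (t : (A ⊗ B) ⊗ C) :
  contract_r (A ⊗ B) h t = tens_map (id_hom A) (contract_r B h) (assoc A B C t).
Proof.
  refine (tens_ext3 (f := contract_r (A ⊗ B) h)
            (g := comp (tens_map (id_hom A) (contract_r B h)) (assoc A B C)) _ _).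
  intros x y z.
  rewrite compE, assoc_pure, tens_map_pure, !contract_r_pure.
  exact (eq_sym (scale_natural (bh_right (pure_bihom A B) x) (h z) y)).
Qed.

Lemma tens_map_swap (A A' B B' : suplattice) (f : sup_hom A A')
  (g : sup_hom B B') (t : A ⊗ B) :
  swap A' B' (tens_map f g t) = tens_map g f (swap A B t).
Proof.
  refine (tens_ext (f := comp (swap A' B') (tens_map f g))
            (g := comp (tens_map g f) (swap A B)) _ _).
  intros x y; now rewrite !compE, swap_pure, !tens_map_pure, swap_pure.
Qed.

(* The open [{ x | exists y, x y ∈ a }]. *)
Definition saturation (M : localic_monoid) : sup_hom M M :=
  comp (contract_r M (full M)) (comul M).

Lemma tens_map_mono (A A' B B' : suplattice) (f f' : sup_hom A A')
  (g g' : sup_hom B B') (t : A ⊗ B) :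
  (forall a, f a ≤ f' a) -> (forall b, g b ≤ g' b) ->
  tens_map f g t ≤ tens_map f' g' t.
Proof.
  intros Hf Hg.
  apply (@le_trans (A' ⊗ B') _ (tens_map f' g t)).
  - exact (sh_mono (bh_left (tens_map_bihom A A' B B') g)
             (Hf : (f : hom A A') ≤ f') t).
  - exact (sh_mono (bh_right (tens_map_bihom A A' B B') f')
             (Hg : (g : hom B B') ≤ g') t).
Qed.

Lemma contract_r_mono (A B : suplattice) (h h' : sup_hom B Omega) (t : A ⊗ B) :
  (forall b, h b ≤ h' b) -> contract_r A h t ≤ contract_r A h' t.
Proof.
  intros H; apply (sh_mono (runit A)), tens_map_mono; auto using le_refl.
Qed.

(** Contracting [mu M a] with [eps] gives [a] by the counit law, and [eps] lies below [full]. *)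
Lemma le_saturation (M : localic_monoid) (a : M) : a ≤ saturation M a.
Proof.
  rewrite <- (mu_unitr a) at 1.
  refine (contract_r_mono (h := eps M) (h' := full M) (mu M a) _).
  exact (le_top ((eps M : sup_hom M Omega) : hom M Omega)).
Qed.

Lemma saturation_le_scale (M : localic_monoid) (M_overt : overt M) (a : M) :
  saturation M a ≤ scale M (full M a) one.
Proof.
  eapply le_trans; [apply (sh_mono (saturation M)), (le_scale_full M_overt)|].
  rewrite scale_natural; apply (sh_mono (bh_right (scale M) (full M a))).
  rewrite ts_two_sided; apply le_top.
Qed.

(** Coassociativity: both sides contract the third factor of the threefold comultiplication of [a]
    with [full]. *)
Lemma comul_saturation_r (M : localic_monoid) (a : M) :
  comul M (saturation M a) = tens_map (id_hom M) (saturation M) (comul M a).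
Proof.
  unfold saturation; rewrite compE, tens_map_split_r, <- comul_assoc.
  now rewrite <- contract_r_assoc, contract_r_map, comp_id_r.
Qed.

Lemma comul_saturation_l (M : localic_monoid) (a : M) :
  comul M (saturation M a) = tens_map (saturation M) (id_hom M) (comul M a).
Proof.
  now rewrite <- comul_comm, comul_saturation_r, tens_map_swap, comul_comm.
Qed.

(** After [comul_saturation_r] the second factor is bounded by a truth value times [one]. That truth
    value moves to the first factor, where it performs the contraction defining [saturation M a],
    and leaves [one] on the right. *)
Lemma saturation_saturated (M : localic_monoid) (M_overt : overt M) (a : M) :
  saturated (saturation M a).
Proof.
  change (comul M (saturation M a) ≤ bh_left (pure_bihom M M) one (saturation M a)).
  rewrite comul_saturation_r.
  apply (@le_trans (M ⊗ M) _ (tens_map (id_hom M)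
    (comp (bh_left (scale M) one) (full M)) (comul M a))).
  - apply tens_map_mono; [intros; apply le_refl|].
    intros b; exact (saturation_le_scale M_overt b).
  - rewrite (tens_ext (f := tens_map (id_hom M) (comp (bh_left (scale M) one) (full M)))
      (g := comp (bh_left (pure_bihom M M) one) (contract_r M (full M)))).
    + apply le_refl.
    + intros x y; rewrite compE, tens_map_pure, contract_r_pure.
      rewrite scale_natural.
      exact (scale_natural (bh_right (pure_bihom M M) x) (full M y) one).
Qed.

(** Contracting the inequality [mu M s ≤ pure s one] with [full] leaves at most [s]. *)
Lemma saturation_fix (M : localic_monoid) (s : M) :
  saturated s -> saturation M s = s.
Proof.
  intros Hs; apply le_antisym; [|apply le_saturation].
  apply (@le_trans _ _ (contract_r M (full M) (qinl M M s))).
  - apply (sh_mono (contract_r M (full M))); exact Hs.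
  - change (contract_r M (full M) (pure s one) ≤ s).
    rewrite contract_r_pure; apply scale_le.
Qed.

Definition saturate (M : localic_monoid) (M_overt : overt M) :
  sup_hom M (saturated_opens M).
Proof.
  exists (fun a => exist _ (saturation M a) (@saturation_saturated M M_overt a)
            : saturated_opens M).
  intros S; apply sig_ext; refine (eq_trans (sh_sup (saturation M) S) _).
  apply (@sup_ext M); intros z; split.
  - intros (a & Sa & <-); eexists; split; [exists a; split; auto|]; reflexivity.
  - intros (k & (a & Sa & <-) & <-); now exists a.
Defined.

Lemma kappa_saturate (M : localic_monoid) (M_overt : overt M) (a : M) :
  kappa M (saturate M_overt a) = saturation M a.
Proof. reflexivity. Qed.

Lemma saturation_factors (M : localic_monoid) (M_overt : overt M) :
  saturation M = comp (kappa M) (saturate M_overt).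
Proof. apply sup_hom_ext; intros a; exact (eq_sym (kappa_saturate M_overt a)). Qed.

Lemma saturate_kappa (M : localic_monoid) (M_overt : overt M)
  (s : saturated_opens M) : saturate M_overt (kappa M s) = s.
Proof. apply sig_ext; exact (saturation_fix (proj2_sig s)). Qed.

Lemma saturation_idem (M : localic_monoid) (M_overt : overt M) (a : M) :
  saturation M (saturation M a) = saturation M a.
Proof. exact (saturation_fix (@saturation_saturated M M_overt a)). Qed.

(** * Monoid ideals as functionals on saturated opens *)

Lemma conv_full (M : localic_monoid) (f : sup_hom M Omega) (a : M) :
  conv f (full M) a = f (saturation M a).
Proof.
  unfold conv, saturation; rewrite !compE.
  refine (tens_ext (f := comp Delta (tens_map f (full M)))
            (g := comp f (contract_r M (full M))) _ _); intros x y.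
  rewrite !compE, tens_map_pure, contract_r_pure, Delta_pure, scale_natural, scale_Omega.
  apply propositional_extensionality; tauto.
Qed.

(** By [conv_full], the nucleus [W ↦ W ⋅ ⊤] is precomposition with [saturation]. *)
Lemma absorbing_iff (M : localic_monoid) (f : sup_hom M Omega) :
  absorbing (Q := sublocale_quantale M) f <-> forall a, f a = f (saturation M a).
Proof.
  unfold absorbing; split.
  - intros H a; rewrite <- conv_full.
    exact (f_equal (fun h : sup_hom M Omega => h a) H).
  - intros H; apply sup_hom_ext; intros a; rewrite (H a); symmetry; apply conv_full.
Qed.

Lemma ideal_saturation (M : localic_monoid) (I : monoid_ideals M) (a : M) :
  ideal_hom I (saturation M a) = ideal_hom I a.
Proof. symmetry; exact (proj1 (absorbing_iff (ideal_hom I)) (proj2_sig I) a). Qed.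

Lemma ideal_ext (M : localic_monoid) (M_overt : overt M)
  (I J : monoid_ideals M) :
  (forall s, saturated s -> ideal_hom I s = ideal_hom J s) -> I = J.
Proof.
  intros H; apply sig_ext, sup_hom_ext; intros a.
  refine (eq_trans (eq_sym (ideal_saturation I a)) (eq_trans _ (ideal_saturation J a))).
  exact (H _ (@saturation_saturated M M_overt a)).
Qed.

Lemma ideal_of_absorbing (M : localic_monoid) (M_overt : overt M)
  (h : sup_hom (saturated_opens M) Omega) :
  absorbing (Q := sublocale_quantale M) (comp h (saturate M_overt)).
Proof.
  apply absorbing_iff; intros a; rewrite !compE; f_equal.
  apply sig_ext; symmetry; exact (saturation_idem M_overt a).
Qed.

(** The inverse of restriction along [kappa]: a functional on saturated opens is extended to all
    opens through the retraction [saturate]. *)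
Definition ideal_of (M : localic_monoid) (M_overt : overt M)
  (h : sup_hom (saturated_opens M) Omega) : monoid_ideals M :=
  exist _ _ (ideal_of_absorbing M_overt h).

Definition ideal_of_hom (M : localic_monoid) (M_overt : overt M) :
  sup_hom (hom (saturated_opens M) Omega) (monoid_ideals M).
Proof.
  exists (fun h : hom (saturated_opens M) Omega => ideal_of M_overt h).
  intros S; apply sig_ext.
  refine (eq_trans (hom_sups (h := fun h : hom (saturated_opens M) Omega =>
    comp (h : sup_hom _ _) (saturate M_overt) : hom M Omega) _ S) _).
  - intros a; exact (sh_sup (eval Omega (saturate M_overt a))).
  - apply (@sup_ext (hom M Omega)); intros z; split.
    + intros (h & Sh & <-); exists (ideal_of M_overt h); split;
        [now exists h|reflexivity].
    + intros (I & (h & Sh & <-) & <-); now exists h.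
Defined.

Lemma ideal_of_kappa (M : localic_monoid) (M_overt : overt M)
  (h : sup_hom (saturated_opens M) Omega) (s : saturated_opens M) :
  ideal_hom (ideal_of M_overt h) (kappa M s) = h s.
Proof.
  change (h (saturate M_overt (kappa M s)) = h s).
  now rewrite saturate_kappa.
Qed.

(** * Evaluation as the counit of a duality *)

Lemma slice_r_ev (M : localic_monoid) (I : monoid_ideals M) :
  slice_r (ev M) I = comp (ideal_hom I) (kappa M).
Proof. apply sup_hom_ext; intros s; exact (ev_pure s I). Qed.

(** Any dual [D] represents functionals on saturated opens, and these are the ideals: [phi d]
    extends [counit (-, d)]. *)
Lemma dual_iso_ideals (M : localic_monoid) (M_overt : overt M) (D : suplattice)
  (counit : sup_hom (saturated_opens M ⊗ D) Omega)
  (unit : sup_hom Omega (D ⊗ saturated_opens M)) :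
  is_duality counit unit ->
  exists phi : sup_hom D (monoid_ideals M),
    is_iso phi /\
    forall (s : saturated_opens M) (d : D),
      ev M (pure s (phi d)) = counit (pure s d).
Proof.
  intros H; destruct (proj1 (is_dualityE counit unit) H) as [H1 H2].
  pose (phi := comp (ideal_of_hom M_overt) (curry_r counit)).
  assert (E : forall s d, ev M (pure s (phi d)) = counit (pure s d)).
  { intros s d; rewrite ev_pure; exact (ideal_of_kappa M_overt (slice_r counit d) s). }
  exists phi; split; [|exact E].
  (* The inverse contracts the unit of the given pair with the restriction of an ideal to saturated
     opens. Each round trip is one of the two triangle identities. *)
  exists (bh_right (transpose_bihom D (ev M)) (unit (top Omega))); split.
  - intros d; refine (eq_trans (transpose_bihomE _ _ _) _).
    rewrite <- (H2 d) at 2.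
    refine (f_equal (fun h => contract_r D h (unit (top Omega))) _).
    apply sup_hom_ext; intros s; exact (E s d).
  - intros I; apply (ideal_ext M_overt); intros s Hs.
    set (s' := exist _ s Hs : saturated_opens M).
    change (ideal_hom (phi (contract_r D (slice_r (ev M) I) (unit (top Omega))))
              (kappa M s')
            = ideal_hom I (kappa M s')).
    rewrite <- ev_pure, E.
    refine (eq_trans (contract_exchange (slice_l counit s') _ _) _).
    rewrite H1; exact (ev_pure s' I).
Qed.

(** The given duality is transported along the isomorphism [phi], which turns its counit into
    [ev]. *)
Lemma ev_duality (M : localic_monoid) (M_overt : overt M) :
  dualisable (saturated_opens M) ->
  exists eta : sup_hom Omega (monoid_ideals M ⊗ saturated_opens M),
    is_duality (ev M) eta.
Proof.
  intros (D & counit & unit & H).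
  destruct (dual_iso_ideals M_overt H) as (phi & (psi & K1 & K2) & E).
  destruct (proj1 (is_dualityE counit unit) H) as [H1 H2].
  exists (comp (tens_map phi (id_hom _)) unit); apply (proj2 (is_dualityE _ _)); split.
  - intros s; rewrite compE, contract_l_map.
    rewrite <- (H1 s) at 2.
    refine (f_equal (fun h => contract_l _ h (unit (top Omega))) _).
    apply sup_hom_ext; intros d; exact (E s d).
  - intros I; rewrite compE, contract_r_map.
    rewrite <- (K2 I) at 2; f_equal.
    rewrite <- (H2 (psi I)).
    refine (f_equal (fun h => contract_r D h (unit (top Omega))) _).
    apply sup_hom_ext; intros s; rewrite compE.
    change (ev M (pure s I) = counit (pure s (psi I))).
    now rewrite <- E, K2.
Qed.

(** [Omega] is the free suplattice on one generator, as [p] is [top Omega] scaled by [p]. *)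
Lemma Omega_hom_ext (A : suplattice) (f g : sup_hom Omega A) :
  f (top Omega) = g (top Omega) -> f = g.
Proof.
  intros H; apply sup_hom_ext; intros p.
  assert (E : p = scale Omega p (top Omega)).
  { rewrite scale_Omega; apply propositional_extensionality; split; [|tauto].
    intros Hp; split; [exact Hp|now exists True]. }
  now rewrite E, !scale_natural, H.
Qed.

Lemma duality_unit_unique (X D : suplattice) (counit : sup_hom (X ⊗ D) Omega)
  (unit unit' : sup_hom Omega (D ⊗ X)) :
  is_duality counit unit -> is_duality counit unit' -> unit = unit'.
Proof.
  intros H K.
  destruct (proj1 (is_dualityE _ _) H) as [H1 H2], (proj1 (is_dualityE _ _) K) as [K1 K2].
  apply Omega_hom_ext, (dual_ext H2); intros x; now rewrite H1, K1.
Qed.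

(** * The interchange of tensor factors and the OPMAI laws *)

Lemma scale_scale (A : suplattice) (p q : Omega) (x : A) :
  scale A p (scale A q x) = scale A ((p : Prop) /\ (q : Prop)) x.
Proof.
  rewrite <- scale_Omega.
  exact (eq_sym (scale_natural (bh_left (scale A) x) p q)).
Qed.

Definition interchange (A B C D : suplattice) :
  bihom (A ⊗ B) (C ⊗ D) ((A ⊗ C) ⊗ (B ⊗ D)) :=
  uncurry (tens_elim (bh_pre (tens_map_bihom C (A ⊗ C) D (B ⊗ D))
                        (curry (pure_bihom A C)) (curry (pure_bihom B D)))).

Lemma interchange_pure (A B C D : suplattice) (a : A) (b : B) (c : C) (d : D) :
  interchange A B C D (pure a b) (pure c d) = pure (pure a c) (pure b d).
Proof.
  unfold interchange.
  change ((tens_elim (bh_pre (tens_map_bihom C (A ⊗ C) D (B ⊗ D))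
             (curry (pure_bihom A C)) (curry (pure_bihom B D))) (pure a b)
           : sup_hom _ _) (pure c d) = pure (pure a c) (pure b d)).
  rewrite tens_elim_pure; exact (tens_map_pure _ _ c d).
Qed.

Lemma contract_l_interchange (A B C D : suplattice) (f : sup_hom A Omega)
  (g : sup_hom C Omega) (t : A ⊗ B) (t' : C ⊗ D) :
  contract_l (B ⊗ D) (comp Delta (tens_map f g)) (interchange A B C D t t')
  = pure (contract_l B f t) (contract_l D g t').
Proof.
  refine (tens_ext2
    (f := bh_post (contract_l (B ⊗ D) (comp Delta (tens_map f g)))
            (interchange A B C D))
    (g := bh_pre (pure_bihom B D) (contract_l B f) (contract_l D g)) _ t t').
  intros a b c d.
  change (contract_l (B ⊗ D) (comp Delta (tens_map f g))
            (interchange A B C D (pure a b) (pure c d))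
    = pure (contract_l B f (pure a b)) (contract_l D g (pure c d))).
  rewrite interchange_pure, !contract_l_pure, Delta_map_pure, Delta_pure.
  refine (eq_sym (eq_trans (scale_natural (bh_left (pure_bihom B D) _) (f a) b) _)).
  refine (eq_trans (f_equal (scale (B ⊗ D) (f a))
                      (scale_natural (bh_right (pure_bihom B D) b) (g c) d)) _).
  apply scale_scale.
Qed.

(** For [m] the product of a quantale this is the source of multiplicativity: contracting a product
    with two independent functionals gives the product of the contractions. *)
Lemma contract_r_interchange (A B C D E : suplattice) (m : bihom A C E)
  (f : sup_hom B Omega) (g : sup_hom D Omega) (t : A ⊗ B) (t' : C ⊗ D) :
  contract_r E (comp Delta (tens_map f g))
    (tens_map (tens_elim m) (id_hom (B ⊗ D)) (interchange A B C D t t'))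
  = m (contract_r A f t) (contract_r C g t').
Proof.
  refine (tens_ext2
    (f := bh_post (contract_r E (comp Delta (tens_map f g)))
            (bh_post (tens_map (tens_elim m) (id_hom (B ⊗ D)))
              (interchange A B C D)))
    (g := bh_pre m (contract_r A f) (contract_r C g)) _ t t').
  intros a b c d.
  change (contract_r E (comp Delta (tens_map f g))
            (tens_map (tens_elim m) (id_hom (B ⊗ D))
              (interchange A B C D (pure a b) (pure c d)))
    = m (contract_r A f (pure a b)) (contract_r C g (pure c d))).
  rewrite interchange_pure, tens_map_pure, !contract_r_pure, tens_elim_pure.
  change (id_hom (B ⊗ D) (pure b d)) with (pure b d : B ⊗ D).
  rewrite Delta_map_pure, Delta_pure.
  refine (eq_sym (eq_trans (scale_natural (bh_left m _) (f b) a) _)).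
  refine (eq_trans (f_equal (scale E (f b))
                      (scale_natural (bh_right m a) (g d) c)) _).
  apply scale_scale.
Qed.

(** On pure tensors [ι₁(p ⊗ a) ⋅ ι₂(q ⊗ b)] is [(p ⋅ q) ⊗ (a ⊗ b)], which is the interchange
    followed by the product of [Q]. The unit law is carried along [Q ⊗ Omega ≅ Q]. *)
Lemma opmaiE (M : localic_monoid) (Q : ts_quantale) (v : Q ⊗ M) :
  is_opmai (v : Q ⊕ M) <->
  contract_r Q (eps M) v = one /\
  tens_map (id_hom Q) (comul M) v
  = tens_map (tens_elim (@mul Q)) (id_hom (M ⊗ M)) (interchange Q M Q M v v).
Proof.
  assert (E : forall v v' : Q ⊗ M,
    tens_mul Q (M ⊕ M) (tens_map (id_hom Q) (qinl M M) v)
      (tens_map (id_hom Q) (qinr M M) v')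
    = tens_map (tens_elim (@mul Q)) (id_hom (M ⊗ M)) (interchange Q M Q M v v')).
  { clear v; intros v v'.
    refine (tens_ext2
      (f := bh_pre (tens_mul Q (M ⊕ M)) (tens_map (id_hom Q) (qinl M M))
              (tens_map (id_hom Q) (qinr M M)))
      (g := bh_post (tens_map (tens_elim (@mul Q)) (id_hom (M ⊗ M)))
              (interchange Q M Q M)) _ v v').
    intros p a q b.
    change (tens_mul Q (M ⊕ M) (tens_map (id_hom Q) (qinl M M) (pure p a))
              (tens_map (id_hom Q) (qinr M M) (pure q b))
      = tens_map (tens_elim (@mul Q)) (id_hom (M ⊗ M))
          (interchange Q M Q M (pure p a) (pure q b))).
    rewrite interchange_pure, !tens_map_pure, tens_elim_pure.
    refine (eq_trans (tens_mul_pure p q (pure a one : M ⊕ M) (pure one b : M ⊕ M)) _).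
    refine (f_equal (pure (p ⋅ q)) _).
    refine (eq_trans (tens_mul_pure a one one b) _).
    now rewrite mul_1l, mul_1r. }
  assert (E1 : runit Q (pure one (top Omega)) = one).
  { now rewrite runit_pure, scale_top. }
  split; intros [H1 H2]; split.
  - refine (eq_trans _ E1); exact (f_equal (runit Q) H1).
  - rewrite <- E; exact H2.
  - refine (eq_trans (eq_sym (runit_K (tens_map (id_hom Q) (eps M) v))) _).
    refine (eq_trans (f_equal (runit_inv Q) H1) _).
    rewrite <- E1; exact (runit_K _).
  - refine (eq_trans H2 (eq_sym (E v v))).
Qed.

Lemma tens_le_ind (A B C : suplattice) (f g : sup_hom (A ⊗ B) C) :
  (forall a b, f (pure a b) ≤ g (pure a b)) -> forall t, f t ≤ g t.
Proof.
  intros H; apply tens_ind; [exact H|].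
  intros S HS; rewrite !sh_sup; apply sup_image_le; intros t St.
  eapply le_trans; [exact (HS t St)|]; apply sup_ub; now exists t.
Qed.

(** On pure tensors the left side is [(p ⋅ q) ⊗ (h d · b)]. Here [p ⋅ q ≤ p] because [Q] is
    two-sided, and scaling by a truth value only decreases [b]. *)
Lemma interchange_contract_le (Q : ts_quantale) (B D : suplattice)
  (h : sup_hom D Omega) (t : Q ⊗ B) (t' : Q ⊗ D) :
  tens_map (id_hom Q) (contract_r B h)
    (tens_map (tens_elim (@mul Q)) (id_hom (B ⊗ D)) (interchange Q B Q D t t'))
  ≤ t.
Proof.
  pose (F := bh_post (tens_map (id_hom Q) (contract_r B h))
    (bh_post (tens_map (tens_elim (@mul Q)) (id_hom (B ⊗ D)))
       (interchange Q B Q D))).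
  refine (tens_le_ind (f := bh_left F t') (g := id_hom (Q ⊗ B)) _ t); clear t.
  intros p b; change (bh_right F (pure p b) t' ≤ pure p b); revert t'; apply tens_ind.
  - intros q d.
    change (tens_map (id_hom Q) (contract_r B h)
      (tens_map (tens_elim (@mul Q)) (id_hom (B ⊗ D))
        (interchange Q B Q D (pure p b) (pure q d))) ≤ pure p b).
    rewrite interchange_pure, !tens_map_pure, tens_elim_pure.
    change (id_hom (B ⊗ D) (pure b d)) with (pure b d : B ⊗ D).
    rewrite contract_r_pure.
    apply (@le_trans (Q ⊗ B) _ (pure p (scale B (h d) b))).
    + exact (sh_mono (bh_left (pure_bihom Q B) (scale B (h d) b)) (ts_mul_le p q)).
    + exact (sh_mono (bh_right (pure_bihom Q B) p) (scale_le (h d) b)).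
  - intros S HS; rewrite sh_sup; apply sup_image_le; exact HS.
Qed.

(** Saturation contracts the second factor of [comul]. The multiplicative law replaces [comul] by a
    product of two copies of [v], and the contracted product lies below the first copy. *)
Lemma opmai_saturation (M : localic_monoid) (Q : ts_quantale) (v : Q ⊗ M) :
  is_opmai (v : Q ⊕ M) -> tens_map (id_hom Q) (saturation M) v = v.
Proof.
  intros H; destruct (proj1 (opmaiE v) H) as [_ H2].
  apply le_antisym.
  - unfold saturation; rewrite tens_map_split_r, H2.
    apply interchange_contract_le.
  - rewrite <- (tens_map_id v) at 1.
    apply tens_map_mono; [intros; apply le_refl|exact (@le_saturation M)].
Qed.

(** * The homomorphism induced by an OPMAI *)

Definition ideal_incl (M : localic_monoid) : sup_hom (monoid_ideals M) (hom M Omega) :=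
  sub_incl (@absorbing_sup (sublocale_quantale M)).

Definition opmai_sup_hom (M : localic_monoid) (Q : ts_quantale) (v : Q ⊗ M) :
  sup_hom (monoid_ideals M) Q :=
  comp (bh_right (contract_r_bihom Q M) v) (ideal_incl M).

Lemma opmai_sup_homE (M : localic_monoid) (Q : ts_quantale) (v : Q ⊗ M)
  (I : monoid_ideals M) : opmai_sup_hom v I = contract_r Q (ideal_hom I) v.
Proof. reflexivity. Qed.

Lemma ideal_hom_mul (M : localic_monoid) (I J : monoid_ideals M) :
  ideal_hom (I ⋅ J) = comp (comp Delta (tens_map (ideal_hom I) (ideal_hom J))) (comul M).
Proof. reflexivity. Qed.

Lemma ideal_hom_one (M : localic_monoid) : ideal_hom (one : monoid_ideals M) = full M.
Proof. reflexivity. Qed.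

Lemma contract_r_comp (A B C : suplattice) (h : sup_hom C Omega)
  (g : sup_hom B C) (t : A ⊗ B) :
  contract_r A (comp h g) t = contract_r A h (tens_map (id_hom A) g t).
Proof. now rewrite contract_r_map. Qed.

Definition opmai_hom (M : localic_monoid) (Q : ts_quantale) (v : Q ⊗ M)
  (Hv : is_opmai (v : Q ⊕ M)) : quantale_hom (monoid_ideals M) Q.
Proof.
  exists (opmai_sup_hom v); destruct (proj1 (opmaiE v) Hv) as [H1 H2].
  - intros I J; rewrite !opmai_sup_homE, ideal_hom_mul.
    rewrite contract_r_comp, H2.
    apply contract_r_interchange.
  (* The unit law concerns [eps], whereas the unit ideal is [full]. Since [eps ≤ full], the image of
     the unit ideal lies above [one], which is the top of [Q]. *)
  - apply le_antisym; [rewrite (ts_two_sided Q); apply le_top|].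
    rewrite opmai_sup_homE, ideal_hom_one, <- H1.
    apply contract_r_mono; intros a.
    exact (le_top ((eps M : sup_hom M Omega) : hom M Omega) a).
Defined.

(** * The universal element and its slices *)

Definition generic (M : localic_monoid)
  (eta : sup_hom Omega (monoid_ideals M ⊗ saturated_opens M)) :
  monoid_ideals M ⊗ M :=
  tens_map (id_hom (monoid_ideals M)) (kappa M) (eta (top Omega)).

Lemma contract_r_generic (M : localic_monoid)
  (eta : sup_hom Omega (monoid_ideals M ⊗ saturated_opens M)) :
  is_duality (ev M) eta ->
  forall I : monoid_ideals M,
    contract_r (monoid_ideals M) (ideal_hom I) (generic eta) = I.
Proof.
  intros H I; destruct (proj1 (is_dualityE _ _) H) as [_ H2].
  unfold generic; rewrite <- contract_r_comp, <- slice_r_ev; apply H2.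
Qed.

Definition eval_at (M : localic_monoid) (a : M) : sup_hom (monoid_ideals M) Omega :=
  bh_left (uncurry (ideal_incl M)) a.

Lemma eval_at_saturate (M : localic_monoid) (M_overt : overt M) (a : M) :
  eval_at a = slice_l (ev M) (saturate M_overt a).
Proof.
  apply sup_hom_ext; intros I.
  refine (eq_trans _ (eq_sym (ev_pure (saturate M_overt a) I))).
  exact (eq_sym (ideal_saturation I a)).
Qed.

Lemma eval_at_kappa (M : localic_monoid) (s : saturated_opens M) :
  eval_at (kappa M s) = slice_l (ev M) s.
Proof. apply sup_hom_ext; intros I; exact (eq_sym (ev_pure s I)). Qed.

(** Ideals do not distinguish [a] from its saturation, so evaluation at [a] is a slice of [ev], and
    the first triangle identity applies. *)
Lemma contract_l_generic (M : localic_monoid) (M_overt : overt M)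
  (eta : sup_hom Omega (monoid_ideals M ⊗ saturated_opens M)) :
  is_duality (ev M) eta ->
  forall a : M, contract_l M (eval_at a) (generic eta) = saturation M a.
Proof.
  intros H a; destruct (proj1 (is_dualityE _ _) H) as [H1 _].
  unfold generic; rewrite contract_l_map, comp_id_r, (eval_at_saturate M_overt), H1.
  reflexivity.
Qed.

(** Extends [(a, b) ↦ e a ⊗ e b] to all tensors, because [comul] of an open is in general not pure.
    Composing with [Delta] gives functionals on [D ⊗ D]. *)
Definition tens_functional (A D : suplattice) (e : sup_hom A (hom D Omega)) :
  sup_hom (A ⊗ A) (hom (D ⊗ D) (Omega ⊗ Omega)) :=
  tens_elim (bh_pre (tens_map_bihom D Omega D Omega) e e).

Lemma tens_functional_pure (A D : suplattice) (e : sup_hom A (hom D Omega)) (a b : A) :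
  tens_functional e (pure a b) = (tens_map (e a) (e b) : hom _ _).
Proof. exact (tens_elim_pure _ a b). Qed.

Lemma contract_l_tens_functional (A B D : suplattice)
  (e : sup_hom A (hom D Omega)) (k k' : sup_hom A B) (t t' : D ⊗ B) :
  (forall a, contract_l B (e a) t = k a) ->
  (forall a, contract_l B (e a) t' = k' a) ->
  forall y : A ⊗ A,
    contract_l (B ⊗ B) (comp Delta (tens_functional e y : sup_hom _ _))
      (interchange D B D B t t')
    = tens_map k k' y.
Proof.
  intros Hk Hk'.
  pose (F := comp (comp (lunit (B ⊗ B)) (tens_map Delta (id_hom (B ⊗ B))))
    (comp (eval _ (interchange D B D B t t'))
      (comp (bh_left (tens_map_bihom (D ⊗ D) (Omega ⊗ Omega) (B ⊗ B) (B ⊗ B))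
               (id_hom (B ⊗ B))) (tens_functional e)))).
  (* [F] is the same expression packaged as a join-preserving map in [z], so that pure tensors
     suffice. *)
  assert (HF : forall z,
    contract_l (B ⊗ B) (comp Delta (tens_functional e z : sup_hom _ _))
      (interchange D B D B t t') = F z).
  { intros z; unfold contract_l, F; rewrite !compE, tens_map_split_l; reflexivity. }
  intros y; rewrite HF; revert y; apply tens_ext; intros a b.
  rewrite <- HF, tens_functional_pure, tens_map_pure, <- Hk, <- Hk'.
  exact (contract_l_interchange (e a) (e b) t t').
Qed.

Definition ideal_eval (M : localic_monoid) : sup_hom M (hom (monoid_ideals M) Omega) :=
  curry (bh_flip (uncurry (ideal_incl M))).

Lemma eval_atE (M : localic_monoid) (a : M) (I : monoid_ideals M) :
  eval_at a I = ideal_hom I a.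
Proof. reflexivity. Qed.

(** The product of ideals is convolution, so evaluating [I ⋅ J] at [s] is evaluating [I] and [J] on
    the two factors of [comul] of [s]. *)
Lemma slice_l_ev_mul (M : localic_monoid) (s : saturated_opens M) :
  comp (slice_l (ev M) s) (tens_elim (@mul (monoid_ideals M)))
  = comp Delta (tens_functional (ideal_eval M) (comul M (kappa M s)) : sup_hom _ _).
Proof.
  apply sup_hom_ext, tens_ext; intros I J.
  rewrite !compE, tens_elim_pure.
  refine (eq_trans (ev_pure s (I ⋅ J)) _); rewrite ideal_hom_mul, !compE.
  f_equal; generalize (comul M (kappa M s)).
  refine (tens_ext (f := tens_map (ideal_hom I) (ideal_hom J))
    (g := comp (eval _ (pure I J)) (tens_functional (ideal_eval M))) _).
  intros a b; rewrite tens_map_pure, compE, tens_functional_pure.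
  exact (eq_sym (tens_map_pure (eval_at a) (eval_at b) I J)).
Qed.

Lemma id_homE (A : suplattice) (x : A) : id_hom A x = x.
Proof. reflexivity. Qed.

Lemma generic_opmai (M : localic_monoid) (M_overt : overt M)
  (eta : sup_hom Omega (monoid_ideals M ⊗ saturated_opens M)) :
  is_duality (ev M) eta -> is_opmai (generic eta : monoid_ideals M ⊕ M).
Proof.
  intros H; pose proof (contract_l_generic M_overt H) as HR.
  apply (proj2 (opmaiE (generic eta))); split.
  (* Evaluation at [s] turns the unit law into [eps (saturation M s) = full M s], which holds
     because [eps] is the unit for convolution with [full]. *)
  - apply (ideal_ext M_overt); intros s Hs.
    rewrite ideal_hom_one, <- eval_atE, contract_exchange, HR, <- conv_full.
    exact (f_equal (fun f : sup_hom M Omega => f s) (conv_1l (full M))).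
  - destruct (proj1 (is_dualityE _ _) H) as [_ H2].
    (* The two sides lie in [monoid_ideals M ⊗ (M ⊗ M)] and are compared slice by slice. *)
    apply (dual_ext H2); intros s.
    rewrite !contract_l_map, !comp_id_r, slice_l_ev_mul, <- eval_at_kappa, HR.
    rewrite id_homE, (contract_l_tens_functional (e := ideal_eval M) HR HR).
    (* Splits [saturation ⊗ saturation] into one factor at a time. Each factor then passes through
       [comul], and idempotence removes the duplicate. *)
    rewrite <- (comp_id_r (saturation M)) at 2.
    rewrite <- (comp_id_l (saturation M)) at 3.
    rewrite tens_map_comp, <- comul_saturation_r, <- comul_saturation_l.
    now rewrite (saturation_idem M_overt).
Qed.

(** * Existence and uniqueness of the classifying homomorphism *)

Lemma opmai_homE (M : localic_monoid) (Q : ts_quantale) (v : Q ⊗ M)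
  (Hv : is_opmai (v : Q ⊕ M)) (I : monoid_ideals M) :
  opmai_hom Hv I = contract_r Q (ideal_hom I) v.
Proof. reflexivity. Qed.

Lemma bh_rightE (A B C : suplattice) (h : bihom A B C) (a : A) (b : B) :
  bh_right h a b = h a b.
Proof. reflexivity. Qed.

Lemma opmai_hom_generic (M : localic_monoid) (M_overt : overt M)
  (eta : sup_hom Omega (monoid_ideals M ⊗ saturated_opens M)) :
  is_duality (ev M) eta ->
  forall (Q : ts_quantale) (v : Q ⊗ M) (Hv : is_opmai (v : Q ⊕ M)),
    tens_map (opmai_hom Hv) (id_hom M) (generic eta) = v.
Proof.
  intros H Q v Hv; destruct (proj1 (is_dualityE _ _) H) as [H1 _].
  (* Exhibits [v] as the image under [kappa] of an element of [Q ⊗ saturated_opens M], which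
     [dual_transpose] then recovers from [eta]. *)
  rewrite <- (opmai_saturation Hv) at 2.
  rewrite (saturation_factors M_overt), tens_map_split_r.
  rewrite <- (dual_transpose H1 (tens_map (id_hom Q) (saturate M_overt) v)).
  unfold generic; rewrite <- !tens_map_comp, !comp_id_l, !comp_id_r.
  refine (f_equal (fun g => tens_map g (kappa M) (eta (top Omega))) _).
  apply sup_hom_ext; intros I.
  rewrite opmai_homE, bh_rightE, transpose_bihomE, <- contract_r_comp, slice_r_ev.
  refine (f_equal (fun h => contract_r Q h v) _).
  apply sup_hom_ext; intros a; exact (eq_sym (ideal_saturation I a)).
Qed.

(** Contraction in the second factor commutes with [g], and contracting the generic element with [I]
    returns [I]. Hence the image of the generic element determines [g], which gives uniqueness. *)
Lemma sup_hom_of_generic_image (M : localic_monoid)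
  (eta : sup_hom Omega (monoid_ideals M ⊗ saturated_opens M)) :
  is_duality (ev M) eta ->
  forall (Q : suplattice) (g : sup_hom (monoid_ideals M) Q) (I : monoid_ideals M),
    g I = contract_r Q (ideal_hom I) (tens_map g (id_hom M) (generic eta)).
Proof.
  intros H Q g I.
  now rewrite contract_r_map, comp_id_r, (contract_r_generic H).
Qed.

Theorem theorem3p15 (M : localic_monoid) (M_overt : overt M)
  (SM_dualisable : dualisable (saturated_opens M)) :
  exists eta : sup_hom Omega (monoid_ideals M ⊗ saturated_opens M),
    is_duality (ev M) eta /\
    (forall eta' : sup_hom Omega (monoid_ideals M ⊗ saturated_opens M),
       is_duality (ev M) eta' -> eta' = eta) /\
    (forall (D : suplattice) (counit : sup_hom (saturated_opens M ⊗ D) Omega)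
            (unit : sup_hom Omega (D ⊗ saturated_opens M)),
       is_duality counit unit ->
       exists phi : sup_hom D (monoid_ideals M),
         is_iso phi /\
         forall (s : saturated_opens M) (d : D),
           ev M (pure s (phi d)) = counit (pure s d)) /\
    exists u : OPMAI M (monoid_ideals M),
      proj1_sig u
        = tens_map (id_hom (monoid_ideals M)) (kappa M) (eta (top Omega)) /\
      represented_by u.
Proof.
  destruct (ev_duality M_overt SM_dualisable) as [eta H].
  exists eta; split; [exact H|split; [|split]].
  - intros eta' H'; exact (duality_unit_unique H' H).
  - intros D counit unit; exact (dual_iso_ideals M_overt (unit := unit)).
  - exists (exist _ (generic eta) (generic_opmai M_overt H)); split; [reflexivity|].
    intros Q [v Hv]; exists (opmai_hom Hv); split.
    + apply sig_ext; exact (opmai_hom_generic M_overt H Hv).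
    + intros g Hg; apply quantale_hom_ext; intros I.
      rewrite (sup_hom_of_generic_image H g I).
      refine (f_equal (contract_r Q (ideal_hom I)) _).
      symmetry; exact (f_equal (@proj1_sig _ _) Hg).
Qed.
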